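(* Let $k,m\ge1$ be integers, $n=k+m$, let $\lambda_1,\dots,\lambda_n$ be Lipschitz functions on $[0,1]$ such that $-\lambda_1(x)<\cdots<-\lambda_k(x)<0<\lambda_{k+1}(x)<\cdots<\lambda_{k+m}(x)$ for every $x\in[0,1]$, and let $\Sigma=\mathrm{diag}(-\lambda_1,\dots,-\lambda_k,\lambda_{k+1},\dots,\lambda_{k+m})$. Let $B\in\mathbb R^{k\times m}$ be such that, for every integer $i$ with $1\le i\le\min\{k,m-1\}$, the $i\times i$ matrix formed from the last $i$ columns and the last $i$ rows of $B$ is invertible. Consider the control system $$\partial_t u(t,x)=\Sigma(x)\partial_x u(t,x),\quad x\in(0,1),\ t>0,$$ $$(u_1,\dots,u_k)^{\mathsf T}(t,0)=B\,(u_{k+1},\dots,u_{k+m})^{\mathsf T}(t,0),\qquad u_{k+j}(t,1)=W_{k+j}(t)\ (1\le j\le m),$$ with controls $W_{k+1},\dots,W_{k+m}$. Then there exists a linear time-independent feedback which yields the null-controllability at the time $T_{opt}$. Assume in addition that the $i\times i$ matrix formed from the last $i$ columns and the last $i$ rows of $B$ is invertible also for $i=\min\{k,m\}$. Then, for any $T$ with $0<T<T_{opt}$, there exists an initial datum such that $u(T,\cdot)\not\equiv0$ for every control.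
   Context: $\tau_i:=\int_0^1\frac{d\xi}{\lambda_i(\xi)}$ for $1\le i\le n$, and $$T_{opt}:=\begin{cases}\max\{\tau_1+\tau_{m+1},\dots,\tau_k+\tau_{m+k},\ \tau_{k+1}\}&\text{if } m\ge k,\\ \max\{\tau_{k+1-m}+\tau_{k+1},\ \tau_{k+2-m}+\tau_{k+2},\dots,\tau_k+\tau_{k+m}\}&\text{if } m<k.\end{cases}$$ Initial data are in $[L^2(0,1)]^n$ and controls on $(0,T)$ are in $[L^2(0,T)]^m$. Solutions are understood in the broad sense, i.e. in $[C([0,T];L^2(0,1))]^n\cap[C([0,1];L^2(0,T))]^n$, satisfying the equations integrated along characteristics, together with the boundary and initial conditions. A linear time-independent feedback is a law of the form $(W_{k+1},\dots,W_{k+m})^{\mathsf T}(t)=\sum_{r=1}^R A_r\,u(t,x_r)+\int_0^1 M(y)u(t,y)\,dy$ with constant matrices $A_r\in\mathbb R^{m\times n}$, points $x_r\in[0,1)$ and $M\in[L^\infty(0,1)]^{m\times n}$ (none depending on $t$ or on the initial datum). It yields the null-controllability at time $T$ if every solution of the resulting closed-loop system satisfies $u(T,\cdot)=0$ on $(0,1)$. *)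

(* Defs.v *)
From HB Require Import structures.
From mathcomp Require Export all_boot all_order all_algebra.
From mathcomp Require Export all_classical all_reals all_analysis.

Set Implicit Arguments.
Unset Strict Implicit.
Unset Printing Implicit Defensive.

Import Order.TTheory GRing.Theory Num.Theory.
Import numFieldNormedType.Exports.

Local Open Scope classical_set_scope.
Local Open Scope ring_scope.

Section Spaces.
Context {R : realType}.
Local Notation mu := (@lebesgue_measure R).

Definition L2 (a b : R) (f : R -> R) : Prop :=
  measurable_fun `]a, b[ f /\
  mu.-integrable `]a, b[ (fun x => (f x ^+ 2)%:E).

Definition L2col (n : nat) (a b : R) (v : R -> 'cV[R]_n) : Prop :=
  forall i, L2 a b (fun x => v x i 0).

Definition sqdist2 (a b : R) (f g : R -> R) : \bar R :=
  (\int[mu]_(x in `]a, b[) ((f x - g x) ^+ 2)%:E)%E.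

(* v : [c, d] -> L^2(a, b) is continuous; v s is a representative of its class *)
Definition continuous_L2 (c d a b : R) (v : R -> R -> R) : Prop :=
  forall s0, s0 \in `[c, d] ->
    L2 a b (v s0) /\
    sqdist2 a b (v s) (v s0) @[s --> within `[c, d] (nbhs s0)] --> 0%E.

Definition Linfty (a b : R) (f : R -> R) : Prop :=
  measurable_fun `]a, b[ f /\
  exists C : R, {ae mu, forall y, y \in `]a, b[ -> `|f y| <= C}.

End Spaces.

Section HyperbolicSystem.
Context {R : realType} (k m : nat).
Local Notation mu := (@lebesgue_measure R).

Implicit Types (lambda : 'I_(k + m) -> R -> R) (B : 'M[R]_(k, m)).
Implicit Types (u : R -> R -> 'cV[R]_(k + m)).

Definition Sigma lambda (x : R) : 'M[R]_(k + m) :=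
  diag_mx (row_mx (\row_i - lambda (lshift m i) x)
                  (\row_j lambda (rshift k j) x)).

(* tau lambda i is tau_i for the 1-based index 1 <= i <= k + m;
   values at other i are not used *)
Definition tau lambda (i : nat) : R :=
  if insub i.-1 is Some j then \int[mu]_(x in `[0, 1]) (lambda j x)^-1 else 0.

(* the initial value 0 of the maxima is harmless, as all tau_i are positive *)
Definition Topt lambda : R :=
  let t := tau lambda in
  if (k <= m)%N
  then Num.max (\big[Num.max/0]_(1 <= i < k.+1) (t i + t (m + i)%N)) (t k.+1)
  else \big[Num.max/0]_(1 <= l < m.+1) (t (k + l - m)%N + t (k + l)%N).

(* rev_ord (widen_ord _ (rev_ord a)) is the index k - i + a (resp. m - i + a) *)
Definition last_block B (i : nat) (ik : (i <= k)%N) (im : (i <= m)%N) : 'M[R]_i :=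
  mxsub (fun a : 'I_i => rev_ord (widen_ord ik (rev_ord a)))
        (fun b : 'I_i => rev_ord (widen_ord im (rev_ord b))) B.

(* t' |-> (t', X t'), for t' in [s, t], is a characteristic of the i-th equation
   staying in the space interval [0, 1] *)
Definition characteristic lambda (i : 'I_(k + m)) (s t : R) (X : R -> R) : Prop :=
  [/\ {within `[s, t], continuous X},
      forall r, r \in `[s, t] -> X r \in `[0, 1] &
      forall r : R, r \in `]s, t[ -> is_derive r 1 X (- Sigma lambda (X r) i i)].

(* The function u represents an element of
   C([0,T]; L^2(0,1))^n /\ C([0,1]; L^2(0,T))^n: each slice u t (resp. u ^~ x)
   represents the value of the first (resp. second) curve, so that the traces at
   x = 0, at x = 1 and at interior points are the slices themselves.
   The equation is integrated along the characteristic through (t, x), backward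
   up to the point where it leaves the set {t > 0, 0 < x < 1}. *)
Record broad_solution lambda B (T : R) (u0 : R -> 'cV[R]_(k + m))
    (W : R -> 'cV[R]_m) u : Prop := BroadSolution {
  sol_measurable : forall i,
    @measurable_fun _ _ (measurableTypeR R * measurableTypeR R)%type
      (measurableTypeR R) (`]0, T[ `*` `]0, 1[) (fun p => u p.1 p.2 i 0);
  sol_continuous_time : forall i,
    continuous_L2 0 T 0 1 (fun t x => u t x i 0);
  sol_continuous_space : forall i,
    continuous_L2 0 1 0 T (fun x t => u t x i 0);
  sol_equation :
    {ae (mu \x mu)%E, forall p, p.1 \in `]0, T[ -> p.2 \in `]0, 1[ ->
      forall (i : 'I_(k + m)) (s : R) (X : R -> R),
        0 <= s < p.1 -> characteristic lambda i s p.1 X -> X p.1 = p.2 ->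
        [\/ s = 0, X s = 0 | X s = 1] ->
        u p.1 p.2 i 0 = u s (X s) i 0};
  sol_initial : {ae mu, forall x, x \in `]0, 1[ -> u 0 x = u0 x};
  sol_left : {ae mu, forall t, t \in `]0, T[ ->
    usubmx (u t 0) = B *m dsubmx (u t 0)};
  sol_right : {ae mu, forall t, t \in `]0, T[ -> dsubmx (u t 1) = W t} }.

Definition vanishes (v : R -> 'cV[R]_(k + m)) : Prop :=
  {ae mu, forall x, x \in `]0, 1[ -> v x = 0}.

Definition feedback_law (N : nat) (A : 'I_N -> 'M[R]_(m, k + m)) (xs : 'I_N -> R)
    (M : R -> 'M[R]_(m, k + m)) u (t : R) : 'cV[R]_m :=
  \sum_r A r *m u t (xs r) +
  \col_j \int[mu]_(y in `]0, 1[) (M y *m u t y) j 0.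

Definition admissible_feedback (N : nat) (xs : 'I_N -> R)
    (M : R -> 'M[R]_(m, k + m)) : Prop :=
  (forall r, xs r \in `[0, 1[) /\ (forall j l, Linfty 0 1 (fun y => M y j l)).

Definition feedback_null_controls lambda B (N : nat)
    (A : 'I_N -> 'M[R]_(m, k + m)) (xs : 'I_N -> R)
    (M : R -> 'M[R]_(m, k + m)) (T : R) : Prop :=
  forall (u0 : R -> 'cV[R]_(k + m)) u, L2col 0 1 u0 ->
    broad_solution lambda B T u0 (feedback_law A xs M u) u -> vanishes (u T).

End HyperbolicSystem.

(* Main.v *)
Require Import Defs.
From mathcomp Require Import measurable_realfun ring lra zify.

(* Let phi_i x be the time a wave of the i-th equation needs to travel from 0 to
   x. Then u_i(t, x) = f_i(phi_i x + t) for i > k and u_i(t, x) = f_i(phi_i x - t)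
   for i <= k, first for almost all (t, x) and then, by continuity in L^2, on
   every slice x = const or t = const. So the system reduces to relations between
   functions of one variable: the boundary condition at x = 0 reads
   f_i(-t) = sum_j B_ij f_{k+j}(t), and u(T, .) = 0 means that f_{k+j} = 0 on
   (T, T + tau_{k+j}) and f_i(-t) = 0 for T - tau_i < t < T.
   For the feedback, Gaussian elimination on the invertible corner blocks of B
   gives relations y_l = sum_{j < l} C_lj y_j which, imposed for all l >= l0,
   annihilate the row k - m + l0 of B y. As tau_{k+l} < tau_{k+j} for j < l, the
   relation between the traces at x = 0 can be prescribed at x = 1, a time
   tau_{k+l} in advance, from point values u_{k+j}(t, x_lj) with x_lj < 1.
   For T < T_opt = tau_i + tau_{k+j} (k + j = m + i), take u_{k+j} = 1 as only
   nonzero initial component: on max(0, T - tau_i) < t < min(T, tau_{k+j}) the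
   vector y of traces at x = 0 has y_j = 1, y_l = 0 for l < j, and the rows
   i, ..., k of B y vanish, which contradicts the invertibility of a block. *)

Set Implicit Arguments.
Unset Strict Implicit.
Unset Printing Implicit Defensive.

Import Order.TTheory GRing.Theory Num.Theory.
Import numFieldNormedType.Exports.

Local Open Scope classical_set_scope.
Local Open Scope ring_scope.

(** * Almost everywhere statements and changes of variable *)

(** [lebesgue_measure] is an outer measure on all sets, which makes it possible to bound preimages
    that are not known to be measurable. *)
Lemma lebesgue_outer_le (R : realType) (A B : set R) : A `<=` B ->
  (lebesgue_measure A <= lebesgue_measure B)%E.
Proof. by rewrite /lebesgue_measure; exact: (@le_mu_ext _ (ocitv_type R)). Qed.

(** The measure of [A] is an infimum over countable covers by half-open intervals, and the preimages
    of such a cover form a cover of the preimage. *)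
Lemma lebesgue_preimage_le (R : realType) (h : R -> R) (K : R) :
  0 < K ->
  (forall a b, a < b ->
     (lebesgue_measure (h @^-1` `]a, b]%classic) <= (K * (b - a))%:E)%E) ->
  forall A : set R,
    (lebesgue_measure (h @^-1` A) <= K%:E * lebesgue_measure A)%E.
Proof.
move=> K0 hK A; rewrite -lee_pdivrMl//.
apply: le_ereal_inf_tmp => _ [F [mF AF] <-]; rewrite lee_pdivrMl//.
rewrite -nneseriesZl; last by move=> n _; exact: wlength_ge0.
have sub : h @^-1` A `<=` \bigcup_n (h @^-1` F n).
  by move=> x /AF[n _ Fn]; exists n.
apply: le_trans (lebesgue_outer_le sub) _.
have := mu_ext_sigma_subadditive (@wlength_ge0 R idfun) (fun n => h @^-1` F n).
move/le_trans; apply.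
apply: lee_nneseries => [n _ _|n _]; first exact: mu_ext_ge0 (@wlength_ge0 R idfun) _.
have /ocitvP[->|[[a b] /= ab ->]] := mF n.
  rewrite preimage_set0 [X in (_ <= _ * X)%E](measure0 _) mule0.
  by rewrite [leLHS](measure0 lebesgue_measure).
by rewrite wlength_itv/= lte_fin ab /= -EFinD -EFinM hK.
Qed.

(** [S] lies within distance [d] of any one of its points, hence in an interval of length
    [2 * d]. *)
Lemma diameter_measure_le (R : realType) (S : set R) (d : R) : 0 <= d ->
  (forall x y, S x -> S y -> `|x - y| <= d) ->
  (lebesgue_measure S <= (2 * d)%:E)%E.
Proof.
move=> d0 dS; have [[x0 Sx0]|S0] := pselect (exists x, S x); last first.
  have -> : S = set0 by rewrite -subset0 => x Sx; apply: S0; exists x.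
  by rewrite [leLHS](measure0 lebesgue_measure) lee_fin mulr_ge0.
have sub : S `<=` `[x0 - d, x0 + d]%classic.
  by move=> x Sx; rewrite /= in_itv/= -ler_distl; exact: dS.
apply: le_trans (lebesgue_outer_le sub) _.
have /= := lebesgue_measure_itv `[x0 - d, x0 + d]; rewrite /lebesgue_measure => ->.
by case: ifPn => _; rewrite -?EFinB lee_fin; lra.
Qed.

(* The preimage of an interval has small diameter, so neither monotonicity nor
   measurability of [h] is needed. *)
Lemma expansive_preimage_le (R : realType) (h : R -> R) (K : R) (A : set R) :
  0 < K -> (forall x y, `|x - y| <= K * `|h x - h y|) ->
  (lebesgue_measure (h @^-1` A) <= (2 * K)%:E * lebesgue_measure A)%E.
Proof.
move=> K0 hK; apply: lebesgue_preimage_le => [|a b ab]; first exact: mulr_gt0.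
rewrite -mulrA; apply: diameter_measure_le => [|x y /= hx hy].
  by rewrite mulr_ge0 ?ltW// subr_gt0.
apply: le_trans (hK _ _) _; rewrite ler_pM2l// ler_norml.
by move: hx hy; rewrite !in_itv/= => /andP[? ?] /andP[? ?]; apply/andP; split; lra.
Qed.

(** The expansion inequality gives [h] a Lipschitz inverse on its image, so null sets pull back to
    null sets. It serves for translations, reflection, [phi] and [psi]. *)
Lemma ae_comp (R : realType) (h : R -> R) (K : R) (P : R -> Prop) : 0 < K ->
  (forall x y, `|x - y| <= K * `|h x - h y|) ->
  {ae lebesgue_measure, forall x, P x} ->
  {ae lebesgue_measure, forall x, P (h x)}.
Proof.
move=> K0 hK /negligible_outer_measure P0; apply/negligible_outer_measure.
apply/eqP; rewrite eq_le outer_measure_ge0 andbT.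
have K20 : 0 < 2 * K by rewrite mulr_gt0.
apply: le_trans (expansive_preimage_le (~` [set x | P x]) K0 hK) _.
by rewrite [X in (_ * X)%E]P0 mule0.
Qed.

(** The pushforward of Lebesgue measure under [h] is at most [2 * K] times Lebesgue measure; the
    crude factor 2 comes from [diameter_measure_le]. *)
Lemma ge0_integral_comp_le (R : realType) (h : R -> R) (K : R) (D : set R)
    (F : R -> \bar R) : 0 < K -> measurable_fun setT h ->
  (forall x y, `|x - y| <= K * `|h x - h y|) ->
  measurable D -> measurable_fun setT F -> (forall x, 0 <= F x)%E ->
  (\int[lebesgue_measure]_(x in h @^-1` D) (F \o h) x <=
   (2 * K)%:E * \int[lebesgue_measure]_(y in D) F y)%E.
Proof.
move=> K0 mh hK mD mF F0.
have K20 : 0 < 2 * K by rewrite mulr_gt0.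
pose h' : measurableTypeR R -> measurableTypeR R := h.
have mh' : measurable_fun setT h' by exact: mh.
have mF' : measurable_fun setT (F : measurableTypeR R -> _) by exact: mF.
apply: (@le_trans _ _
  (\int[pushforward lebesgue_measure h']_(y in D) F y)%E).
  rewrite ge0_integral_pushforward //; exact: measurable_funTS.
pose K2 := NngNum (ltW K20).
rewrite (_ : (2 * K)%:E = (K2%:num)%:E)//.
rewrite -(ge0_integral_mscale lebesgue_measure mD K2)//; last exact: measurable_funTS.
apply: (ge0_le_measure_integral
  (m1 := measure_function_pushforward__canonical__measure_function_Measure
    lebesgue_measure mh')) => // S mS.
exact: expansive_preimage_le.
Qed.

Lemma lebesgue_measure_shift (R : realType) (s : R) (A : set R) : measurable A ->
  pushforward lebesgue_measure (fun x : R => (x + s : measurableTypeR R)) A =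
  lebesgue_measure A.
Proof.
move=> mA; apply/esym/lebesgue_measure_unique => //=.
  by apply: measurable_funD.
move=> ms _ [[a b]] _ <-.
rewrite /pushforward [X in _ = lebesgue_measure X](_ : _ = `]a - s, b - s]%classic).
  rewrite [LHS]lebesgue_measure_itv [RHS]lebesgue_measure_itv/= !lte_fin ltrD2r.
  by case: ifP => // _; rewrite -!EFinD; congr EFin; ring.
by apply/seteqP; split => x /=; rewrite !in_itv/= ltrBlDr lerBrDr.
Qed.

(** Tonelli: the measures of the sections of a null set integrate to 0, so almost all of them are
    0. *)
Lemma ae_product1 (R : realType) (P : R * R -> Prop) :
  {ae (@lebesgue_measure R \x @lebesgue_measure R)%E, forall p, P p} ->
  {ae lebesgue_measure, forall x : R,
    {ae lebesgue_measure, forall y : R, P (x, y)}}.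
Proof.
move=> [A [mA A0 PA]].
have : ae_eq lebesgue_measure setT
    (lebesgue_measure \o xsection A : R -> \bar R) (cst 0%E).
  apply/ae_eq_integral_abs => //; first exact: measurable_fun_xsection.
  by rewrite -[RHS]A0; apply: eq_integral => x _; rewrite gee0_abs.
apply: filterS => x /(_ I) /= xA.
exists (xsection A x); split => //; first exact: measurable_xsection.
by move=> y /= Py; rewrite /xsection/= inE; exact: PA.
Qed.

Lemma ae_product2 (R : realType) (P : R * R -> Prop) :
  {ae (@lebesgue_measure R \x @lebesgue_measure R)%E, forall p, P p} ->
  {ae lebesgue_measure, forall y : R,
    {ae lebesgue_measure, forall x : R, P (x, y)}}.
Proof.
move=> [A [mA A0 PA]].
(* The product measure built in the other order agrees on rectangles, hence coincides with the first
   by uniqueness. *)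
have A0' : (lebesgue_measure \x^ lebesgue_measure)%E A = 0%E.
  rewrite -[RHS]A0; symmetry; apply: product_measure_unique => //= B C mB mC.
  exact: product_measure2E.
have : ae_eq lebesgue_measure setT
    (lebesgue_measure \o ysection A : R -> \bar R) (cst 0%E).
  apply/ae_eq_integral_abs => //; first exact: measurable_fun_ysection.
  by rewrite -[RHS]A0'; apply: eq_integral => x _; rewrite gee0_abs.
apply: filterS => y /(_ I) /= yA.
exists (ysection A y); split => //; first exact: measurable_ysection.
by move=> x /= Px; rewrite /ysection/= inE; exact: PA.
Qed.

Lemma aeS (R : realType) (P Q : R -> Prop) :
  (forall x, P x -> Q x) ->
  {ae @lebesgue_measure R, forall x, P x} ->
  {ae @lebesgue_measure R, forall x, Q x}.
Proof. by move=> PQ; apply: filterS => //; exact: (ae_filter_ringOfSetsType lebesgue_measure). Qed.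

Lemma aeS2 (R : realType) (P P' Q : R -> Prop) :
  (forall x, P x -> P' x -> Q x) ->
  {ae @lebesgue_measure R, forall x, P x} ->
  {ae @lebesgue_measure R, forall x, P' x} ->
  {ae @lebesgue_measure R, forall x, Q x}.
Proof. by move=> PQ; apply: filterS2 => //; exact: (ae_filter_ringOfSetsType lebesgue_measure). Qed.

Lemma ae_forall (R : realType) (I : finType) (P : I -> R -> Prop) :
  (forall i, {ae @lebesgue_measure R, forall x, P i x}) ->
  {ae @lebesgue_measure R, forall x, forall i, P i x}.
Proof.
by move=> aeP; apply: filter_forall => //; exact: (ae_filter_ringOfSetsType lebesgue_measure).
Qed.

(** Turns an almost everywhere statement into a witness: an interval of positive length is not a
    null set. *)
Lemma ae_itv_ex (R : realType) (p q : R) (P : R -> Prop) : p < q ->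
  {ae @lebesgue_measure R, forall x, p < x < q -> P x} ->
  exists2 x, p < x < q & P x.
Proof.
move=> pq /negligible_outer_measure P0; apply/not_exists2P => nP.
have : (lebesgue_measure (`]p, q[%classic : set R) <= 0)%E.
  rewrite -[leRHS]P0; apply: lebesgue_outer_le => x /=; rewrite in_itv/= => pxq.
  by have := nP x; rewrite pxq; case=> // nPx /(_ isT).
by rewrite [leLHS]lebesgue_measure_itv/= lte_fin pq -EFinB lee_fin subr_le0 leNgt pq.
Qed.

(** * Translations in L^1 *)

Section Translation.
Context {R : realType}.
Local Notation mu := (@lebesgue_measure R).

Lemma integrable_shift (w : R -> R) (s : R) :
  mu.-integrable setT (EFin \o w) ->
  mu.-integrable setT (EFin \o (fun y => w (y + s))).
Proof.
move=> iw; have mw : measurable_fun setT w.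
  by move/measurable_int : iw => /measurable_EFinP.
have ms : measurable_fun setT (fun y : R => y + s) by exact: measurable_funD.
apply/integrableP; split.
  by apply/measurable_EFinP; exact: measurableT_comp mw ms.
case/integrableP : iw => _; apply: le_lt_trans.
pose h : measurableTypeR R -> measurableTypeR R := fun y => y + s.
have mh : measurable_fun setT h by exact: ms.
rewrite [leLHS](_ : _ =
    (\int[mu]_(x in h @^-1` setT) ((fun x => `|(w x)%:E|) \o h) x)%E)//.
rewrite -ge0_integral_pushforward//; last first.
  by apply: measurableT_comp => //; exact/measurable_EFinP.
rewrite (eq_measure_integral mu)// => A mA _.
exact: lebesgue_measure_shift.
Qed.

Lemma Rintegral_shift (w : R -> R) (s : R) (A : set R) : measurable A ->
  mu.-integrable setT (EFin \o w) ->
  \int[mu]_(y in (fun y => y + s) @^-1` A) w (y + s) = \int[mu]_(y in A) w y.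
Proof.
move=> mA iw; have mw : measurable_fun setT w.
  by move/measurable_int : iw => /measurable_EFinP.
pose h : measurableTypeR R -> measurableTypeR R := fun y => y + s.
have mh : measurable_fun setT h by exact: measurable_funD.
rewrite /Rintegral; congr fine.
rewrite [LHS](_ : _ =
    (\int[mu]_(x in h @^-1` A) ((EFin \o w) \o h) x)%E)//.
rewrite -integral_pushforward//; last 2 first.
- exact/measurable_EFinP.
- apply: integrableS (integrable_shift s iw) => //.
  by rewrite -[X in measurable X]setTI; exact: mh.
by apply: eq_measure_integral => B mB _; exact: lebesgue_measure_shift.
Qed.

(** Absolute continuity of the integral; [d] is uniform in the lower endpoint [a]. *)
Lemma Rintegral_interval_continuous (w : R -> R) (e : R) : 0 < e ->
  mu.-integrable setT (EFin \o w) ->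
  exists2 d : R, 0 < d & forall a b c : R, `|b - c| < d -> a <= b -> a <= c ->
    `| \int[mu]_(y in `]a, b]) w y - \int[mu]_(y in `]a, c]) w y | < e.
Proof.
move=> e0 iw; have [d [d0 dw]] := integral_normr_continuous iw e0.
exists d => // a b c.
wlog bc : b c / c <= b => [wl|].
  have [cb|/ltW bc] := leP c b; first exact: wl.
  by rewrite distrC => ? ? ?; rewrite distrC; exact: wl.
move=> bcd ab ac.
have iab A : measurable A -> mu.-integrable A (EFin \o w).
  by move=> mA; apply: integrableS iw.
rewrite Rintegral_itvB//; last exact: iab.
apply: le_lt_trans (le_normr_Rintegral _ _) _ => //; first exact: iab.
apply: dw => //; rewrite [ltLHS]lebesgue_measure_itv/= lte_fin.
case: ifP => _; last by rewrite lte_fin.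
by rewrite -EFinB lte_fin (le_lt_trans (ler_norm _)).
Qed.

(** By Lebesgue differentiation [f] is almost everywhere the derivative of its primitive, which is
    constant on the interval. *)
Lemma ae_eq0_interval (f : R -> R) (p q : R) :
  mu.-integrable setT (EFin \o f) ->
  (forall x, p < x < q -> \int[mu]_(y in `]p, x]) f y = 0) ->
  {ae mu, forall x, p < x < q -> f x = 0}.
Proof.
move=> fi f0.
have fl : locally_integrable setT f.
  exact: open_integrable_locally openT fi.
have := @FTC1 R f (BRight p) _ fl; rewrite /=.
have fi' y : mu.-integrable [set` Interval (BRight p) (BRight y)] (EFin \o f).
  by apply: integrableS fi.
move=> /(_ fi'); apply: filterS; first exact: (ae_filter_ringOfSetsType mu).
move=> x + /andP[px xq].
move=> /(_ px)[_ <-].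
have -> : (0 : R) = derive1 (cst (0 : R)) x by rewrite derive1_cst.
rewrite !derive1E; apply: near_eq_derive.
have : x \in `]p, q[ by rewrite in_itv/= px.
move=> /near_in_itvoo; apply: filterS => y; rewrite in_itv/= => ypq.
exact: f0.
Qed.

Lemma integrable_EFinB (D : set R) (f g : R -> R) : measurable D ->
  mu.-integrable D (EFin \o f) -> mu.-integrable D (EFin \o g) ->
  mu.-integrable D (EFin \o (fun x => f x - g x)).
Proof.
move=> mD fi gi.
rewrite (_ : _ \o _ = ((EFin \o f) \- (EFin \o g))%E)//.
exact: integrableB.
Qed.

(* Testing against intervals avoids the continuity of translations in L^1. *)
Lemma ae_eq_shift_limit (w v : R -> R) (p q s : R) :
  mu.-integrable setT (EFin \o w) -> mu.-integrable setT (EFin \o v) ->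
  (forall e : R, 0 < e -> exists2 s' : R, `|s' - s| < e &
     \int[mu]_(y in `]p, q[) `|v y - w (y + s')| < e) ->
  {ae mu, forall y, p < y < q -> v y = w (y + s)}.
Proof.
move=> iw iv lim.
have iws := integrable_shift s iw.
have iD : mu.-integrable setT (EFin \o (fun y => v y - w (y + s))).
  exact: integrable_EFinB.
suff : {ae mu, forall y, p < y < q -> v y - w (y + s) = 0}.
  by apply: aeS => y /[apply]/eqP; rewrite subr_eq0 => /eqP.
apply: ae_eq0_interval => // x /andP[px xq].
apply/eqP; rewrite -normr_le0; apply/ler_addgt0Pr => e e0; rewrite add0r.
(* One third bounds the L^1 distance to the translate by [s']; the other two bound the effect of
   replacing [s'] by [s] at the two endpoints. *)
have e30 : 0 < e / 3 by rewrite divr_gt0.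
have [d d0 dw] := Rintegral_interval_continuous e30 iw.
have [|s' ss' vs'] := lim (Num.min d (e / 3)) _; first by rewrite lt_min d0.
move: ss' vs'; rewrite !lt_min => /andP[ss' _] /andP[_ vs'].
have iS f A : measurable A -> mu.-integrable setT (EFin \o f) ->
    mu.-integrable A (EFin \o f).
  by move=> mA iw'; apply: integrableS iw'.
rewrite RintegralB//; try exact: iS.
have sh t : \int[mu]_(y in `]p, x]) w (y + t) = \int[mu]_(y in `]p + t, x + t]) w y.
  rewrite -[RHS](Rintegral_shift t)//.
  rewrite (_ : (fun y => y + t) @^-1` _ = `]p, x]%classic)//.
  by apply/seteqP; split => y /=; rewrite !in_itv/= ltrD2r lerD2r.
have iws' := integrable_shift s' iw.
have iD' : mu.-integrable setT (EFin \o (fun y => v y - w (y + s'))).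
  exact: integrable_EFinB.
have D1 : `|\int[mu]_(y in `]p, x]) v y - \int[mu]_(y in `]p, x]) w (y + s')| < e / 3.
  rewrite -RintegralB//; try exact: iS.
  apply: le_lt_trans (le_normr_Rintegral _ _) _ => //; first exact: iS.
  apply: le_lt_trans vs'.
  have iN A : measurable A ->
      mu.-integrable A (EFin \o (fun y => `|v y - w (y + s')|)).
    by move=> mA; apply: integrable_norm; exact: iS.
  rewrite /Rintegral fine_le//; [exact: integrable_fin_num (iN _ _)..|].
  apply: ge0_subset_integral => //.
  - by apply: measurable_int (iN _ _).
  - by apply: subset_itvl; rewrite bnd_simp.
(* With this common lower endpoint every shifted integral is a difference of two integrals of [w]
   from [a], so that passing from [s'] to [s] moves upper endpoints only. *)
pose a := p + Num.min s s'.
have G t : s <= t \/ s' <= t ->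
  \int[mu]_(y in `]p, x]) w (y + t) =
  \int[mu]_(y in `]a, x + t]) w y - \int[mu]_(y in `]a, p + t]) w y.
  move=> ts; rewrite sh Rintegral_itvB//; first exact: iS.
    by rewrite bnd_simp lerD2l ge_min; case: ts => ->; rewrite ?orbT.
  by rewrite bnd_simp lerD2r ltW.
have as1 y : p <= y -> (a <= y + s) && (a <= y + s').
  by move=> py; rewrite !lerD// ge_min lexx ?orbT.
have /andP[as2 as3] := as1 _ (lexx p).
have /andP[as4 as5] := as1 _ (ltW px).
have B y : p <= y -> `|\int[mu]_(y in `]a, y + s']) w y -
    \int[mu]_(y in `]a, y + s]) w y| < e / 3.
  move=> /as1/andP[? ?]; apply: dw => //.
  by rewrite opprD addrACA subrr add0r.
have Bp := B _ (lexx p); have Bx := B _ (ltW px).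
move: D1; rewrite !G; [|by left|by right].
move: Bp Bx; rewrite !ltr_norml ler_norml; clear => /andP[? ?] /andP[? ?] /andP[? ?].
by apply/andP; split; lra.
Qed.
End Translation.

(** * Slices of L^2-continuous curves *)

Section Slices.
Context {R : realType}.
Local Notation mu := (@lebesgue_measure R).

Lemma continuous_L2_near (c d a b : R) (v : R -> R -> R) (s0 e : R) :
  continuous_L2 c d a b v -> s0 \in `[c, d] -> 0 < e ->
  exists2 r : R, 0 < r & forall s, s \in `[c, d] -> `|s - s0| < r ->
    (sqdist2 a b (v s) (v s0) < e%:E)%E.
Proof.
move=> vc s0cd e0; have [_ /= lim] := vc _ s0cd.
have /lim /= : nbhs (0 : \bar R)%E [set x : \bar R | (x < e%:E)%E].
  exact: (@open_ereal_lt' R 0%E e%:E).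
move=> /nbhs_ballP[r /= r0 rP]; exists r => // s scd sr; apply: rP => //=.
by rewrite /ball/= distrC.
Qed.

(** Integrates the Young-type inequality [t <= e + t ^+ 2 / e], which stands in for Cauchy-Schwarz;
    [e] is chosen by the caller. *)
Lemma L1_le_sqdist (a b : R) (f g : R -> R) (e : R) : 0 < e -> a < b ->
  measurable_fun `]a, b[ f -> measurable_fun `]a, b[ g ->
  (\int[mu]_(x in `]a, b[) `|f x - g x|%:E <=
   (e * (b - a))%:E + e^-1%:E * sqdist2 a b f g)%E.
Proof.
move=> e0 ab mf mg.
have mfg : measurable_fun `]a, b[ (fun x => f x - g x) by exact: measurable_funB.
have ms : measurable_fun `]a, b[ (fun x => ((f x - g x) ^+ 2)%:E).
  by apply/measurable_EFinP; exact: measurable_funX.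
rewrite /sqdist2 -ge0_integralZl//; last 2 first.
- by move=> x _; rewrite lee_fin sqr_ge0.
- by rewrite lee_fin invr_ge0 ltW.
have -> : (e * (b - a))%:E = (\int[mu]_(x in `]a, b[) e%:E)%E.
  rewrite integral_cst// [X in (_ * X)%E](_ : _ = (b - a)%:E) -?EFinM//.
  by rewrite [LHS]lebesgue_measure_itv/= lte_fin ab.
rewrite -ge0_integralD//; last 2 first.
- by move=> x _; rewrite -EFinM lee_fin mulr_ge0 ?sqr_ge0 ?invr_ge0 ?ltW.
- exact: measurable_funeM.
apply: ge0_le_integral => //.
- by apply/measurable_EFinP; exact: measurableT_comp.
- by apply: emeasurable_funD => //; exact: measurable_funeM.
move=> x _; rewrite -EFinM -EFinD lee_fin -[X in _ <= _ + _ * X]real_normK ?num_real//.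
set t := `|_|; have t0 : 0 <= t by exact: normr_ge0.
rewrite -(ler_pM2l e0) mulrDr [e * (_^-1 * _)]mulrA divff ?gt_eqF// mul1r.
have h1 := sqr_ge0 (e - t); have h2 : 0 <= e * t by rewrite mulr_ge0// ltW.
  by move: h1 h2; rewrite sqrrB !expr2 mulr2n; lra.
by move=> x _; rewrite lee_fin ltW.
Qed.

Lemma L2_integrable (a b : R) (f : R -> R) : a < b -> L2 a b f ->
  mu.-integrable `]a, b[ (EFin \o f).
Proof.
move=> ab [mf /integrableP[_ fi]].
apply/integrableP; split; first exact/measurable_EFinP.
have := @L1_le_sqdist a b f (cst 0) 1 ltr01 ab mf (@measurable_cst _ _ _ _ _ _).
under eq_integral do rewrite /= subr0.
move=> /le_lt_trans; apply.
rewrite lte_add_pinfty ?ltry// invr1 mul1e /sqdist2.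
under eq_integral do rewrite /= subr0.
apply: le_lt_trans fi; apply: ge0_le_integral => //.
- by move=> x _; rewrite lee_fin sqr_ge0.
- by apply/measurable_EFinP; exact: measurable_funX.
- by apply: measurableT_comp => //; apply/measurable_EFinP; exact: measurable_funX.
- by move=> x _; exact: lee_abs.
Qed.

Lemma integrable_comp (a b K : R) (u g' : R -> R) : 0 < K ->
  measurable_fun setT g' ->
  (forall x y, `|x - y| <= K * `|g' x - g' y|) ->
  mu.-integrable `]a, b[ (EFin \o u) ->
  mu.-integrable setT (EFin \o ((u \_ `]a, b[) \o g')) /\
  (\int[mu]_x `|((u \_ `]a, b[) (g' x))%:E| <=
    (2 * K)%:E * \int[mu]_(x in `]a, b[) `|(u x)%:E|)%E.
Proof.
move=> K0 mg gK ui.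
have mu0 : measurable_fun setT (u \_ `]a, b[).
  have um : measurable_fun `]a, b[ u.
    by move/measurable_int : ui => /measurable_EFinP.
  by apply: (measurable_restrictT u _).1.
have le : (\int[mu]_x `|((u \_ `]a, b[) (g' x))%:E| <=
    (2 * K)%:E * \int[mu]_(x in `]a, b[) `|(u x)%:E|)%E.
  rewrite [in leRHS]integral_mkcond.
  have mN : measurable_fun setT (fun x => `|((u \_ `]a, b[) x)%:E|%E).
    by apply: measurableT_comp => //; apply/measurable_EFinP; exact: mu0.
  have := ge0_integral_comp_le K0 mg gK measurableT mN (fun=> abse_ge0 _).
  rewrite preimage_setT => /le_trans; apply.
  rewrite lee_pmul2l ?lte_fin ?mulr_gt0// le_eqVlt; apply/orP; left; apply/eqP.
  by apply: eq_integral => x _; rewrite !patchE; case: ifP => //; rewrite abse0.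
split=> //; apply/integrableP; split.
  by apply/measurable_EFinP; exact: measurableT_comp mu0 mg.
apply: le_lt_trans le _; apply: lte_mul_pinfty => //.
  by rewrite lee_fin mulr_ge0// ltW.
by case/integrableP : ui.
Qed.

(** In the variable [y = g r], almost all slices are translates of each other, by differences of
    values of [h]. Continuity in L^2 carries this relation to the limit [s0]. As [f] is arbitrary,
    nothing is integrated but the slices themselves. *)
Lemma slice_eq (a b c d K : R) (v : R -> R -> R) (f h g g' : R -> R) :
  a < b -> c < d -> 0 < K -> cancel g g' -> cancel g' g ->
  {mono g : x y / x < y} ->
  (forall x y, `|g x - g y| <= K * `|x - y|) ->
  (forall x y, `|g' x - g' y| <= K * `|x - y|) ->
  (forall x y, `|h x - h y| <= K * `|x - y|) ->
  continuous_L2 c d a b v ->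
  {ae mu, forall s, c < s < d ->
    {ae mu, forall r, a < r < b -> v s r = f (h s + g r)}} ->
  forall s0, s0 \in `[c, d] ->
    {ae mu, forall r, a < r < b -> v s0 r = f (h s0 + g r)}.
Proof.
move=> ab cd K0 gK g'K gmono gL g'L hL vc fv s0 s0cd.
have gexp x y : `|x - y| <= K * `|g x - g y|.
  by rewrite -{1}(gK x) -{1}(gK y) g'L.
have g'exp x y : `|x - y| <= K * `|g' x - g' y|.
  by rewrite -{1}(g'K x) -{1}(g'K y) gL.
have mg' : measurable_fun setT g'.
  apply: continuous_measurable_fun => x; apply/cvgrPdist_lt => e e0.
  near=> y; apply: le_lt_trans (g'L _ _) _; rewrite -ltr_pdivlMl//.
  by near: y; apply: cvgr_dist_lt => //; rewrite mulr_gt0 ?invr_gt0.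
have g'itv y : (a < g' y < b) = (g a < y < g b).
  by rewrite -[in RHS](g'K y) !gmono.
(* The slice in the variable [y = g r], extended by zero so that it can be translated. *)
pose V s := (v s \_ `]a, b[) \o g'.
have L2v s : s \in `[c, d] -> L2 a b (v s) by move=> /vc[].
have iV s : s \in `[c, d] -> mu.-integrable setT (EFin \o V s).
  by move=> scd; apply: (integrable_comp K0 mg' g'exp _).1; apply: L2_integrable => //; exact: L2v.
pose good s := c < s < d /\ {ae mu, forall r, a < r < b -> v s r = f (h s + g r)}.
have VE s y : g a < y < g b -> V s y = v s (g' y).
  by move=> yab; rewrite /V /= patchE ifT// inE/= in_itv/= g'itv.
have goodV s : good s -> {ae mu, forall y, g a < y < g b -> V s y = f (h s + y)}.
  move=> [_ /(ae_comp K0 g'exp)]; apply: aeS => y.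
  by rewrite g'K g'itv => H yab; rewrite VE// H.
have good_near e : 0 < e -> exists2 s, good s & `|s - s0| < e.
  move=> e0.
  have [||s /andP[sl su] gs] := @ae_itv_ex R (Num.max c (s0 - e)) (Num.min d (s0 + e))
      (fun s => {ae mu, forall r, a < r < b -> v s r = f (h s + g r)}).
  - move: s0cd; rewrite in_itv/= => /andP[? ?].
    by rewrite gt_max !lt_min; apply/andP; split; apply/andP; split; lra.
  - apply: aeS fv => s sP /andP[]; rewrite gt_max lt_min => /andP[? _] /andP[? _].
    by apply: sP; apply/andP.
  move: sl su; rewrite gt_max lt_min => /andP[? ?] /andP[? ?].
  exists s; first by split => //; apply/andP.
  by rewrite ltr_norml; apply/andP; split; lra.
(* Translates are compared on an interval shrunk by [e], so that small shifts stay inside; these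
   intervals then exhaust the whole one. *)
suff main : forall e, 0 < e ->
    {ae mu, forall y, g a + e < y < g b - e -> V s0 y = f (h s0 + y)}.
  have : {ae mu, forall y, g a < y < g b -> V s0 y = f (h s0 + y)}.
    have /ae_foralln : forall n, {ae mu, forall y,
        g a + n.+1%:R^-1 < y < g b - n.+1%:R^-1 -> V s0 y = f (h s0 + y)}.
      by move=> n; apply: main; rewrite invr_gt0.
    apply: aeS => y yn /andP[ay yb].
    have [n _ nP] : \forall n \near \oo, n.+1%:R^-1 < Num.min (y - g a) (g b - y).
      by apply: near_infty_natSinv_lt (PosNum _); rewrite lt_min !subr_gt0 ay.
    move: (yn n) (nP n (leqnn n)); rewrite /= lt_min.
    by move: (n.+1%:R^-1) => t ynt /andP[? ?]; apply: ynt; apply/andP; split; lra.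
  move=> /(ae_comp K0 gexp); apply: aeS => r + rab.
  have gr : g a < g r < g b by rewrite !gmono.
  by move=> /(_ gr); rewrite VE// gK.
move=> e e0.
have subab y : g a + e < y < g b - e -> g a < y < g b.
  by move=> /andP[? ?]; apply/andP; split; lra.
have e20 : 0 < e / 2 / K by rewrite !divr_gt0.
(* The good slice at [s1] replaces [f]: its translates represent [f (h s + y)] for every [s] close
   to [s0]. *)
have [s1 gs1 s1e] := good_near _ e20.
have hs s : `|s - s0| < e / 2 / K -> `|h s - h s0| < e / 2.
  by move=> sl; apply: le_lt_trans (hL _ _) _; rewrite mulrC -ltr_pdivlMr.
have good_cd s : good s -> s \in `[c, d].
  by move=> [/andP[? ?] _]; rewrite in_itv/= !ltW.
have shiftE s : `|s - s0| < e / 2 / K -> {ae mu, forall y,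
    g a + e < y < g b - e -> V s1 (y + (h s - h s1)) = f (h s + y)}.
  move=> se; have K1 (x y : R) : `|x - y| <= 1 * `|x + (h s - h s1) - (y + (h s - h s1))|.
    by rewrite opprD addrACA subrr addr0 mul1r.
  have := ae_comp ltr01 K1 (goodV _ gs1); apply: aeS => y /= + yab.
  rewrite (_ : h s1 + _ = h s + y); last by ring.
  apply; have := hs _ se; have := hs _ s1e; rewrite !ltr_norml.
  by move: yab => /andP[? ?] /andP[? ?] /andP[? ?]; apply/andP; split; lra.
have step : {ae mu, forall y, g a + e < y < g b - e ->
    V s0 y = V s1 (y + (h s0 - h s1))}.
  apply: ae_eq_shift_limit => [||e1 e10]; [exact: iV (good_cd _ gs1)|exact: iV|].
  have ba : 0 < b - a by rewrite subr_gt0.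
  (* Chosen so that both terms of [L1_le_sqdist] are at most [e1 / (8 * K)]; after the factor
     [2 * K] of the change of variable the total is at most [e1 / 2]. *)
  pose d1 := e1 / (8 * K * (b - a)).
  have d10 : 0 < d1 by rewrite divr_gt0// mulr_gt0// mulr_gt0.
  have n0 : 0 < d1 * e1 / (8 * K) by rewrite divr_gt0 // mulr_gt0.
  have [r r0 rP] := continuous_L2_near vc s0cd n0.
  have [|s gs] := good_near (Num.min (e1 / K) (Num.min (e / 2 / K) r)).
    by rewrite !lt_min r0 e20 divr_gt0.
  rewrite !lt_min => /and3P[se1 se sr]; exists (h s - h s1).
    rewrite opprB addrA subrK; apply: le_lt_trans (hL _ _) _.
    by rewrite mulrC -ltr_pdivlMr.
  have scd := good_cd _ gs.
  pose u x := v s x - v s0 x.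
  have mv t : t \in `[c, d] -> measurable_fun `]a, b[ (v t) by move=> /L2v[].
  have iu : mu.-integrable `]a, b[ (EFin \o u).
    by apply: integrable_EFinB => //; apply: L2_integrable => //; exact: L2v.
  have lt1 : (\int[mu]_x `|((u \_ `]a, b[) (g' x))%:E| < e1%:E)%E.
    apply: le_lt_trans (integrable_comp K0 mg' g'exp iu).2 _.
    have := L1_le_sqdist d10 ab (mv _ scd) (mv _ s0cd).
    have := rP _ scd sr.
    have : (0 <= sqdist2 a b (v s) (v s0))%E.
      by apply: integral_ge0 => x _; rewrite lee_fin sqr_ge0.
    case: (sqdist2 _ _ _ _) => // D D0; rewrite lte_fin => Dlt.
    rewrite -EFinM -EFinD => lei.
    have K2 : (0 <= (2 * K)%:E)%E by rewrite lee_fin mulr_ge0// ltW.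
    apply: le_lt_trans (lee_wpmul2l K2 lei) _; rewrite -EFinM lte_fin.
    have d1D : d1^-1 * D < e1 / (8 * K).
      by rewrite -ltr_pdivlMl ?invr_gt0// invrK mulrA.
    have -> : d1 * (b - a) = e1 / (8 * K).
      by rewrite /d1; field; rewrite !gt_eqF.
    have : 2 * K * (e1 / (8 * K) + d1^-1 * D) < 2 * K * (e1 / (8 * K) + e1 / (8 * K)).
      by rewrite ltr_pM2l ?mulr_gt0// ltrD2l.
    move/lt_trans; apply.
    have -> : 2 * K * (e1 / (8 * K) + e1 / (8 * K)) = e1 / 2 by field; rewrite gt_eqF.
    lra.
  have iw : mu.-integrable setT (EFin \o (fun y => V s0 y - V s1 (y + (h s - h s1)))).
    apply: integrable_EFinB => //; first exact: iV.
    by apply: integrable_shift; exact: iV (good_cd _ gs1).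
  have mw : measurable_fun setT (fun y => V s0 y - V s1 (y + (h s - h s1))).
    by move/measurable_int : iw => /measurable_EFinP.
  have mW : measurable_fun setT (fun y => (`|V s0 y - V s1 (y + (h s - h s1))|)%:E).
    by apply/measurable_EFinP; exact: measurableT_comp mw.
  have mU : measurable_fun setT (fun y => `|((u \_ `]a, b[) (g' y))%:E|%E).
    have [/measurable_int mU _] := integrable_comp K0 mg' g'exp iu.
    by apply: measurableT_comp => //; exact: mU.
  have lt2 : (\int[mu]_(y in `](g a + e)%R, (g b - e)%R[)
      (`|V s0 y - V s1 (y + (h s - h s1))|)%R%:E < e1%:E)%E.
    apply: le_lt_trans lt1.
    apply: (@le_trans _ _ (\int[mu]_(y in `](g a + e)%R, (g b - e)%R[)
        `|((u \_ `]a, b[) (g' y))%:E|)%E); last first.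
      by apply: ge0_subset_integral => //; exact: mU.
    (* For a good [s] the translate of [V s1] is almost everywhere [V s], so the integrand is the
       distance between the slices at [s] and [s0]. *)
    rewrite le_eqVlt; apply/orP; left; apply/eqP; apply: ge0_ae_eq_integral => //.
    - exact: measurable_funTS mW.
    - exact: measurable_funTS mU.
    have := aeS2 _ (shiftE s se) (goodV _ gs); apply => y H1 H2.
    rewrite /= in_itv/= => yab; have yab' := subab _ yab.
    rewrite (H1 yab) -(H2 yab') (VE s0 y yab') (VE s y yab') patchE ifT.
      by rewrite distrC.
    by rewrite inE/= in_itv/= g'itv.
  by rewrite /Rintegral -lte_fin fineK// ge0_fin_numE ?integral_ge0// (lt_trans lt2) ?ltry.
apply: aeS2 step (shiftE s0 _) => [y H1 H2 yab|]; last by rewrite subrr normr0.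
by rewrite H1// H2.
Unshelve. all: by end_near. Qed.
End Slices.

(** * Travel times *)

Section TravelTime.
Context {R : realType}.
Local Notation mu := (@lebesgue_measure R).

(** On [[0, 1]], [phi] is the primitive of [1 / l] vanishing at 0, and [psi] is its inverse. Both
    are required to be Lipschitz bijections of the whole line, so that the global change of variable
    lemmas apply. *)
Record travel_time (l phi psi : R -> R) (K : R) : Prop := TravelTime {
  tt_gt0 : 0 < K;
  tt_K : cancel phi psi;
  tt_Kinv : cancel psi phi;
  tt_mono : {mono phi : x y / x < y};
  tt_lip : forall x y, `|phi x - phi y| <= K * `|x - y|;
  tt_lip_inv : forall x y, `|psi x - psi y| <= K * `|x - y|;
  tt_0 : phi 0 = 0;
  tt_1 : phi 1 = \int[mu]_(x in `[0, 1]) (l x)^-1;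
  tt_derive : forall x, 0 < x < 1 -> is_derive (phi x) 1 psi (l x) }.

Definition clamp (x : R) : R := Num.max 0 (Num.min x 1).

Lemma clamp_itv x : 0 <= clamp x <= 1.
Proof. by rewrite /clamp le_max lexx ge_max ler01 ge_min lexx orbT. Qed.

Lemma clamp_id x : 0 <= x <= 1 -> clamp x = x.
Proof. by move=> /andP[x0 x1]; rewrite /clamp min_l// max_r. Qed.

Lemma clamp_le x y : x <= y -> 0 <= clamp y - clamp x <= y - x.
Proof.
move=> xy; rewrite /clamp.
by case: (leP x 1) => ?; case: (leP y 1) => ?; case: (leP 0 x) => ?;
  case: (leP 0 y) => ?; case: (leP (0 : R) 1) => ?; apply/andP; split; lra.
Qed.

Lemma lipschitz_unit_itv (l : R -> R) :
  [lipschitz l x | x in `[0, 1]%classic] ->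
  exists2 M : R, 0 < M & forall x y, 0 <= x <= 1 -> 0 <= y <= 1 ->
    `|l x - l y| <= M * `|x - y|.
Proof.
(* [[lipschitz ...]] asserts the bound for all large constants; a positive one beyond the threshold
   [M] is picked. *)
move=> [M [_ MP]]; exists (Num.max 1 (M + 1)); first by rewrite lt_max ltr01.
move=> x y x01 y01; have := MP (Num.max 1 (M + 1)) _ (x, y); apply.
  by rewrite lt_max ltrDl ltr01 orbT.
by split; rewrite /= in_itv.
Qed.

Lemma lipschitz_clamp_continuous (l : R -> R) :
  [lipschitz l x | x in `[0, 1]%classic] -> continuous (l \o clamp).
Proof.
move=> /lipschitz_unit_itv[M M0 lM].
move=> x; apply/cvgrPdist_lt => e e0.
near=> y; apply: le_lt_trans (lM _ _ (clamp_itv _) (clamp_itv _)) _.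
rewrite -ltr_pdivlMl//.
have cd u v : `|clamp u - clamp v| <= `|u - v|.
  wlog uv : u v / u <= v => [wl|].
    have [|/ltW vu] := leP u v; first exact: wl.
    by rewrite (distrC (clamp u)) (distrC u); exact: wl.
  have /andP[h1 h2] := clamp_le uv.
  rewrite (distrC (clamp u)) (distrC u) (ger0_norm h1) ger0_norm// subr_ge0//.
apply: le_lt_trans (cd _ _) _.
by near: y; apply: cvgr_dist_lt => //; rewrite mulr_gt0 ?invr_gt0.
Unshelve. all: by end_near. Qed.

(** [1 / l] lies between two positive constants on [[0, 1]], so its primitive is bilipschitz there;
    the inverse function theorem gives the derivative of [psi]. *)
Lemma travel_time_exists (l : R -> R) :
  [lipschitz l x | x in `[0, 1]%classic] ->
  (forall x, 0 <= x <= 1 -> 0 < l x) ->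
  exists phi psi K, travel_time l phi psi K.
Proof.
move=> llip l0.
pose lc x := l (clamp x).
have lc0 x : 0 < lc x by exact: l0 (clamp_itv x).
have lcc : continuous lc by exact: lipschitz_clamp_continuous.
pose p x := (lc x)^-1.
have pc : continuous p.
  by move=> x; apply: cvgV; [rewrite gt_eqF|exact: lcc].
have p0 x : 0 < p x by rewrite invr_gt0.
have [m m0 [M1 pmM]] : exists2 m : R, 0 < m & exists M1 : R, forall x, m <= p x <= M1.
  have pw : {within `[0, 1], continuous p} by apply: continuous_subspaceT.
  have [c1 _ c1P] := EVT_min ler01 pw; have [c2 _ c2P] := EVT_max ler01 pw.
  exists (p c1) => //; exists (p c2) => x.
  rewrite (_ : p x = p (clamp x)); last by rewrite /p /lc (@clamp_id (clamp x))// clamp_itv.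
  by apply/andP; split; [apply: c1P|apply: c2P]; rewrite in_itv/= clamp_itv.
have pi a b : mu.-integrable `[a, b] (EFin \o p).
  by apply: continuous_compact_integrable; [exact: segment_compact|exact: continuous_subspaceT].
pose Phi x := \int[mu]_(y in `[0, x]) p y.
have PhiB x y : 0 <= x -> x <= y -> m * (y - x) <= Phi y - Phi x <= M1 * (y - x).
  move=> x0 xy; rewrite Rintegral_itvB//; [|by rewrite bnd_simp..].
  have ii : mu.-integrable `]x, y] (EFin \o p).
    by apply: integrableS (pi x y) => //; apply: subset_itvr; rewrite bnd_simp.
  have ic (c : R) : mu.-integrable `]x, y] (EFin \o cst c).
    by apply: integrableS (continuous_compact_integrable (segment_compact (a := x) (b := y)) _) => //;
       [apply: subset_itvr; rewrite bnd_simp|apply: continuous_subspaceT => ?; exact: cvg_cst].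
  have cE (c : R) : \int[mu]_(t in `]x, y]) c = c * (y - x).
    rewrite Rintegral_cst//; congr (_ * _).
    rewrite [X in fine X](_ : _ = (y - x)%:E)//.
    rewrite [LHS]lebesgue_measure_itv/= lte_fin; case: ltP => //.
    by move=> yx; rewrite (_ : y = x) ?subrr//; apply/eqP; rewrite eq_le yx.
  by rewrite -!cE; apply/andP; split; apply: le_Rintegral => //; try exact: ic;
    move=> t _; case/andP: (pmM t).
(* extended with slope 1, so that phi is a bilipschitz bijection of R *)
pose phi x := Phi (clamp x) + (x - clamp x).
(* [K] dominates the upper slopes [M1] and 1 of [phi], and [K^-1] is below its lower slopes [m] and
   1, so one constant serves [phi] and its inverse. *)
pose K := Num.max 1 (Num.max M1 m^-1).
have K1 : 1 <= K by rewrite le_max lexx.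
have K0 : 0 < K by apply: lt_le_trans K1.
have KM : M1 <= K by rewrite !le_max lexx orbT.
have Km : K^-1 <= m.
  by rewrite -[leRHS]invrK lef_pV2 ?posrE ?invr_gt0// !le_max lexx !orbT.
have KV1 : K^-1 <= 1 by rewrite invf_le1.
have phiB x y : x <= y -> K^-1 * (y - x) <= phi y - phi x <= K * (y - x).
  move=> xy; have /andP[h1 h2] := clamp_le xy.
  have /andP[cx0 _] := clamp_itv x; rewrite subr_ge0 in h1.
  have /andP[h3 h4] := PhiB _ _ cx0 h1; rewrite -subr_ge0 in h1.
  rewrite -subr_ge0 in h2.
  have l1 := ler_wpM2r h1 Km; have l2 := ler_wpM2r h1 KM.
  have l3 := ler_wpM2r h2 KV1; have l4 := ler_wpM2r h2 K1.
  move: h3 h4 l1 l2 l3 l4; rewrite /phi.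
  set d := clamp y - clamp x; set A := Phi _; set B := Phi _.
  set e := y - x - d; have -> : y - x = d + e by rewrite /e; ring.
  have -> : A + (y - clamp y) - (B + (x - clamp x)) = A - B + e.
    by rewrite /e /d; ring.
  rewrite !mulrDr !mul1r => h3 h4 l1 l2 l3 l4.
  apply/andP; split; apply: lerD => //.
    exact: le_trans l1 h3.
  exact: le_trans h4 l2.
have phimono : {mono phi : x y / x < y}.
  apply: leW_mono; apply: le_mono => x y xy.
  rewrite -subr_gt0; have /andP[+ _] := phiB _ _ (ltW xy).
  by apply: lt_le_trans; rewrite mulr_gt0 ?invr_gt0// subr_gt0.
have philip x y : `|phi x - phi y| <= K * `|x - y|.
  wlog xy : x y / x <= y => [wl|].
    have [|/ltW yx] := leP x y; first exact: wl.
    by rewrite (distrC (phi x)) (distrC x); exact: wl.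
  rewrite (distrC (phi x)) (distrC x) (@ger0_norm _ (y - x)) ?subr_ge0//.
  have /andP[a1 a2] := phiB _ _ xy; rewrite ger0_norm//.
  by apply: le_trans a1; rewrite mulr_ge0 ?invr_ge0 ?subr_ge0// ltW.
have phiexp x y : `|x - y| <= K * `|phi x - phi y|.
  wlog xy : x y / x <= y => [wl|].
    have [|/ltW yx] := leP x y; first exact: wl.
    by rewrite (distrC (phi x)) (distrC x); exact: wl.
  rewrite (distrC (phi x)) (distrC x) (@ger0_norm _ (y - x)) ?subr_ge0//.
  have /andP[a1 a2] := phiB _ _ xy; rewrite -ler_pdivrMl//.
  exact: le_trans a1 (ler_norm _).
have phic : continuous phi.
  move=> x; apply/cvgrPdist_lt => e e0.
  near=> y; apply: le_lt_trans (philip _ _) _; rewrite -ltr_pdivlMl//.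
  by near: y; apply: cvgr_dist_lt => //; rewrite mulr_gt0 ?invr_gt0.
have phi0 : phi 0 = 0.
  rewrite /phi clamp_id ?lexx ?ler01// subrr addr0 /Phi set_itv1.
  exact: Rintegral_set1.
have surj c : exists x, phi x = c.
  (* Since [phi 0 = 0] and the slope is at least [K^-1], the values of [phi] at the two ends of this
     interval enclose [c]. *)
  have [|||x _ xc] := @IVT R phi (- (K * `|c|)) (K * `|c|) c.
  - by rewrite ge0_cp ?mulr_ge0// ltW.
  - exact: continuous_subspaceT.
  - have Kc0 : 0 <= K * `|c| by rewrite mulr_ge0// ltW.
    have Kc0' : - (K * `|c|) <= 0 by rewrite oppr_le0.
    have /andP[+ _] := phiB _ _ Kc0; have /andP[+ _] := phiB _ _ Kc0'.
    rewrite phi0 subr0 sub0r opprK add0r mulKf ?gt_eqF// => a1 a2.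
    rewrite ge_min le_max; have := ler_norm c; have := ler_norm (- c); rewrite normrN.
    move=> a3 a4; apply/andP; split; apply/orP; [left|right]; lra.
  by exists x.
pose psi c := sval (cid (surj c)).
have psiK : cancel psi phi by move=> c; rewrite /psi; case: cid.
have phiK : cancel phi psi.
  move=> x; apply/eqP; rewrite -subr_eq0 -normr_le0.
  by apply: le_trans (phiexp _ _) _; rewrite psiK subrr normr0 mulr0.
exists phi, psi, K; split => //.
- by move=> x y; apply: le_trans (phiexp _ _) _; rewrite !psiK.
- rewrite /phi clamp_id ?lexx ?ler01// subrr addr0; apply: eq_Rintegral => x.
  by rewrite inE/= in_itv/= => x01; rewrite /p /lc clamp_id.
move=> x x01.
have -> : l x = (p x)^-1.
  by rewrite invrK /lc clamp_id//; case/andP: x01 => ? ?; rewrite !ltW.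
apply: is_derive_inverse; [near=> y; exact: phiK|near=> y; exact: phic| |by rewrite gt_eqF].
have [x0 x1] := andP x01.
have [dF Fx] := continuous_FTC1_closed x1 (pi 0 1) x0 (pc x).
apply: (@near_eq_is_derive _ _ _ Phi).
  have : x \in `]0, 1[ by rewrite in_itv/= x0.
  move=> /near_in_itvoo; apply: filterS => y; rewrite in_itv/= => /andP[y0 y1].
  by rewrite /phi clamp_id ?ltW// subrr addr0.
by apply: DeriveDef; [exact: dF|rewrite -derive1E; exact: Fx].
Unshelve. all: by end_near. Qed.
End TravelTime.

(** * Solutions along characteristics *)

Section Transport.
Context {R : realType} (k m : nat).
Local Notation mu := (@lebesgue_measure R).
Implicit Types (lambda : 'I_(k + m) -> R -> R) (B : 'M[R]_(k, m)).

(* Along the characteristics of the i-th equation, [speed_sign i * t + phi x] is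
   constant, for the travel time [phi] of that equation. *)
Definition speed_sign (i : 'I_(k + m)) : R := if (i < k)%N then -1 else 1.

Lemma SigmaE lambda x (i : 'I_(k + m)) :
  Sigma lambda x i i = speed_sign i * lambda i x.
Proof.
rewrite /Sigma /speed_sign !mxE eqxx mulr1n.
case: splitP => j ij; rewrite mxE.
  rewrite (_ : lshift m j = i); last exact: val_inj.
  by rewrite mulN1r.
rewrite (_ : rshift k j = i); last exact: val_inj.
by rewrite mul1r.
Qed.

Lemma speed_sign_sq i : speed_sign i * speed_sign i = 1.
Proof. by rewrite /speed_sign; case: ifP => _; rewrite ?mulrNN mulr1. Qed.

Lemma psi_itvcc (l phi psi : R -> R) (K c : R) : travel_time l phi psi K ->
  0 <= c <= phi 1 -> 0 <= psi c <= 1.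
Proof.
move=> tt /andP[c0 c1]; rewrite !leNgt -(tt_mono tt _ 0) -(tt_mono tt 1).
by rewrite (tt_Kinv tt) (tt_0 tt) -!leNgt c0.
Qed.

Lemma psi_itvoo (l phi psi : R -> R) (K c : R) : travel_time l phi psi K ->
  0 < c < phi 1 -> 0 < psi c < 1.
Proof.
by move=> tt; rewrite -(tt_mono tt 0 (psi c)) -(tt_mono tt (psi c)) (tt_Kinv tt) (tt_0 tt).
Qed.

Lemma phi_itvoo (l phi psi : R -> R) (K x : R) : travel_time l phi psi K ->
  0 < x < 1 -> 0 < phi x < phi 1.
Proof. by move=> tt; rewrite -(tt_mono tt 0 x) -(tt_mono tt x 1) (tt_0 tt). Qed.

(** The argument of [psi] is affine in [r], so it stays in [[0, phi 1]] as soon as its values at [s]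
    and [t] do; the chain rule then yields the slope [- Sigma]. *)
Lemma characteristic_travel_time lambda i (phi psi : R -> R) (K s t x : R) :
  travel_time (lambda i) phi psi K -> 0 < x < 1 -> s < t ->
  0 <= phi x + speed_sign i * (t - s) <= phi 1 ->
  characteristic lambda i s t (fun r => psi (phi x + speed_sign i * (t - r))).
Proof.
move=> tt x01 st /andP[c0 c1]; have /andP[x0 x1] := phi_itvoo tt x01.
have K0 := tt_gt0 tt.
split.
- apply: continuous_subspaceT => r; apply/cvgrPdist_lt => e e0.
  near=> y; apply: le_lt_trans (tt_lip_inv tt _ _) _; rewrite -ltr_pdivlMl//.
  rewrite (_ : _ - _ = speed_sign i * (y - r)); last by ring.
  rewrite normrM (_ : `|speed_sign i| = 1) ?mul1r; last first.
    by rewrite /speed_sign; case: ifP; rewrite ?normrN normr1.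
  rewrite distrC.
  by near: y; apply: cvgr_dist_lt => //; rewrite mulr_gt0 ?invr_gt0.
- move=> r; rewrite !in_itv/= => /andP[sr rt]; apply: (psi_itvcc tt).
  move: c0 c1; rewrite /speed_sign; case: ifP => _ c0 c1; apply/andP; split; lra.
- move=> r; rewrite in_itv/= => /andP[sr rt].
  have cr : 0 < phi x + speed_sign i * (t - r) < phi 1.
    by move: c0 c1; rewrite /speed_sign; case: ifP => _ c0 c1; apply/andP; split; lra.
  have d1 := tt_derive tt (psi_itvoo tt cr); rewrite (tt_Kinv tt) in d1.
  have d2 : is_derive r 1 (fun r => phi x + speed_sign i * (t - r)) (- speed_sign i).
    by apply: is_derive_eq; rewrite add0r !mul1r /GRing.scale/= mulrN1.
  rewrite SigmaE.
  have d3 := @is_derive1_comp _ psi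
    (fun r => phi x + speed_sign i * (t - r)) r _ _ d1 d2.
  by apply: (is_derive_eq d3); rewrite mulrC mulNr.
Unshelve. all: by end_near. Qed.

(** The exit point of the backward characteristic through [(t, x)] depends only on
    [speed_sign i * t + phi x]. This gives [f] for almost all [(t, x)]; sections of null sets and
    [slice_eq] extend it to every slice. *)
Lemma transport lambda B (T : R) (u0 : R -> 'cV[R]_(k + m)) (W : R -> 'cV[R]_m)
    (u : R -> R -> 'cV[R]_(k + m)) (i : 'I_(k + m)) (phi psi : R -> R) (K : R) :
  0 < T -> travel_time (lambda i) phi psi K -> broad_solution lambda B T u0 W u ->
  exists2 f : R -> R,
    forall x, x \in `[0, 1] ->
      {ae mu, forall t, 0 < t < T -> u t x i 0 = f (speed_sign i * t + phi x)} &
    forall t, t \in `[0, T] ->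
      {ae mu, forall x, 0 < x < 1 -> u t x i 0 = f (speed_sign i * t + phi x)}.
Proof.
move=> T0 tt sol.
(* the value of u where the characteristic leaves {t > 0, 0 < x < 1} backward *)
pose f c := if 0 <= c <= phi 1 then u 0 (psi c) i 0
            else if phi 1 < c then u (c - phi 1) 1 i 0 else u (- c) 0 i 0.
have pt : {ae (mu \x mu)%E, forall p, 0 < p.1 < T -> 0 < p.2 < 1 ->
    u p.1 p.2 i 0 = f (speed_sign i * p.1 + phi p.2)}.
  have := sol_equation sol.
  apply: filterS; first exact: (ae_filter_ringOfSetsType (mu \x mu)%E).
  move=> -[t x] /= + tT x01.
  rewrite !in_itv/= => /(_ tT x01 i) eq.
  have char s := characteristic_travel_time tt x01 (s := s) (t := t).
  have /andP[x0 x1] := phi_itvoo tt x01; have /andP[t0 _] := tT.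
  have X0 : psi (phi x + speed_sign i * (t - t)) = x.
    by rewrite subrr mulr0 addr0 (tt_K tt).
  rewrite /f; case: ifPn => [c01|].
    have c0 : 0 <= phi x + speed_sign i * (t - 0) <= phi 1 by rewrite subr0 addrC.
    rewrite (eq 0 _ _ (char _ t0 c0) X0) ?lexx//; last by constructor.
    by rewrite subr0 addrC.
  rewrite negb_and -!ltNge; case: ifPn => [c1 _|].
    (* As [phi x < phi 1], the value [phi 1] is exceeded only with the sign 1; the characteristic
       then starts on [x = 1] at time [t + phi x - phi 1]. *)
    have si : speed_sign i = 1.
      by move: c1; rewrite /speed_sign; case: ifP => // _; lra.
    move: c1; rewrite si mul1r => c1.
    have E : phi x + speed_sign i * (t - (t + phi x - phi 1)) = phi 1.
      by rewrite si; ring.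
    have st : t + phi x - phi 1 < t by lra.
    have s01 : 0 <= t + phi x - phi 1 < t by rewrite st andbT; lra.
    have cE : 0 <= phi x + speed_sign i * (t - (t + phi x - phi 1)) <= phi 1.
      by rewrite E lexx andbT; lra.
    rewrite (eq _ _ s01 (char _ st cE) X0) E (tt_K tt)//.
    by constructor 3.
  move=> _; rewrite orbF => c0.
  have si : speed_sign i = -1.
    by move: c0; rewrite /speed_sign; case: ifP => // _; lra.
  move: c0; rewrite si mulN1r => c0.
  have E : phi x + speed_sign i * (t - (- (- t + phi x))) = 0.
    by rewrite si; ring.
  have st : - (- t + phi x) < t by lra.
  have s01 : 0 <= - (- t + phi x) < t by rewrite st andbT; lra.
  have cE : 0 <= phi x + speed_sign i * (t - (- (- t + phi x))) <= phi 1.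
    by rewrite E lexx/=; lra.
  have psi0 : psi 0 = 0 by rewrite -{1}(tt_0 tt) (tt_K tt).
  rewrite (eq _ _ s01 (char _ st cE) X0) E psi0//.
  by constructor 2.
(* [K + 1] is a Lipschitz constant for [phi] and [psi] as well as for the identity and the
   reflection. *)
have K0 := tt_gt0 tt; have K1 : 0 < K + 1 by rewrite addr_gt0.
have le1 (x y : R) : `|x - y| <= (K + 1) * `|x - y|.
  by rewrite ler_peMl// lerDr ltW.
have leK (x : R) : K * `|x| <= (K + 1) * `|x| by rewrite ler_wpM2r// lerDl.
have ns (x y : R) : `|speed_sign i * x - speed_sign i * y| = `|x - y|.
  rewrite -mulrBr normrM /speed_sign; case: ifP => _; by rewrite ?normrN normr1 mul1r.
exists f => [x xI|t tI].
  (* For fixed [x] the slice variable is [t] itself, so [f] is precomposed with the sign, which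
     squares to 1. For fixed [t], below, the slice variable is changed by [phi]. *)
  have := @slice_eq R 0 T 0 1 (K + 1) (fun x t => u t x i 0)
    (fun z => f (speed_sign i * z)) (fun x => speed_sign i * phi x) id id T0 ltr01 K1.
  have E t y : speed_sign i * (speed_sign i * phi y + t) = speed_sign i * t + phi y.
    by rewrite mulrDr mulrA speed_sign_sq mul1r addrC.
  move=> /(_ (fun=> erefl) (fun=> erefl) (fun _ _ => erefl) le1 le1 _
    (sol_continuous_space sol i) _ x xI) H.
  apply: aeS (H _ _) => [t|y z|]; first by rewrite E.
    by rewrite ns; apply: le_trans (tt_lip tt _ _) _.
  by apply: aeS (ae_product2 pt) => y Hy y01; apply: aeS Hy => r Hr r01; rewrite E; exact: Hr.
apply: (@slice_eq R 0 1 0 T (K + 1) (fun t x => u t x i 0) f _ phi psi) => //.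
- exact: tt_K tt.
- exact: tt_Kinv tt.
- exact: tt_mono tt.
- by move=> y z; apply: le_trans (tt_lip tt _ _) _.
- by move=> y z; apply: le_trans (tt_lip_inv tt _ _) _.
- by move=> y z; rewrite ns.
- exact: sol_continuous_time sol i.
by apply: aeS (ae_product1 pt) => r Hr r01; apply: aeS Hr => y Hy y01; exact: Hy.
Qed.
End Transport.

(** * Corner blocks *)

Section LinearAlgebra.
Context {R : realType} (k m : nat).
Implicit Types B : 'M[R]_(k, m).

(** The index map inside [last_block], spelled identically so that the two agree by unfolding. *)
Definition last_ord n r (rn : (r <= n)%N) (a : 'I_r) : 'I_n :=
  rev_ord (widen_ord rn (rev_ord a)).

Lemma last_ordE n r (rn : (r <= n)%N) (a : 'I_r) :
  last_ord rn a = (n - r + a)%N :> nat.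
Proof. by rewrite /=; have := ltn_ord a; lia. Qed.

Lemma last_ordP n r (rn : (r <= n)%N) (i : 'I_n) : (n - r <= i)%N ->
  exists a, i = last_ord rn a.
Proof.
move=> ri; have ai : (i - (n - r) < r)%N by have := ltn_ord i; lia.
by exists (Ordinal ai); apply: val_inj => /=; lia.
Qed.

(** [a] is the first row of the inverse block, padded with zeros on the left. *)
Lemma last_block_row B r (rk : (r <= k)%N) (rm : (r <= m)%N) : (0 < r)%N ->
  last_block B rk rm \in unitmx ->
  exists2 a : 'rV[R]_k, forall i : 'I_k, (i < k - r)%N -> a 0 i = 0 &
    forall j : 'I_m, (m - r <= j)%N -> (a *m B) 0 j = (j == (m - r)%N :> nat)%:R.
Proof.
case: r rk rm => // r rk rm _ uD.
pose b : 'rV[R]_r.+1 := row 0 (invmx (last_block B rk rm)).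
have bD : b *m last_block B rk rm = row 0 1%:M by rewrite -row_mul mulVmx.
move: b bD => b bD; exists (b *m rowsub (last_ord rk) 1%:M) => [i ir|j].
  rewrite mxE big1// => x _; rewrite !mxE; case: eqP => [/(congr1 val)/= xi|]; last by rewrite mulr0.
  by have := ltn_ord x; lia.
move=> /(last_ordP rm)[y ->]; rewrite -mulmxA mul_rowsub_mx mul1mx.
transitivity ((b *m last_block B rk rm) 0 y).
  by rewrite !mxE; apply: eq_bigr => x _; rewrite !mxE.
rewrite bD !mxE; congr (_%:R); congr nat_of_bool.
apply/eqP/eqP => [<-/=|/= yE]; first by lia.
by apply: val_inj => /=; have := ltn_ord y; lia.
Qed.

(** The nonzero part of [a] is a row vector annihilated by the invertible block. *)
Lemma last_block_row_inj B r (rk : (r <= k)%N) (rm : (r <= m)%N) :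
  last_block B rk rm \in unitmx -> forall a : 'rV[R]_k,
  (forall i : 'I_k, (i < k - r)%N -> a 0 i = 0) ->
  (forall j : 'I_m, (m - r <= j)%N -> (a *m B) 0 j = 0) -> a = 0.
Proof.
move=> uD a a0 aB0; pose b := colsub (last_ord rk) a.
have aE : a = b *m rowsub (last_ord rk) 1%:M.
  apply/rowP => i; rewrite mxE; have [ri|ri] := leqP (k - r) i; last first.
    rewrite a0// big1// => x _; rewrite !mxE; case: eqP => [/(congr1 val)/= xi|]; last by rewrite mulr0.
    by have := ltn_ord x; lia.
  have [x ->] := last_ordP rk ri.
  rewrite (bigD1 x)//= !mxE eqxx mulr1 big1 ?addr0// => y yx.
  rewrite !mxE; case: eqP => [/(congr1 val)/= E|]; last by rewrite mulr0.
  case/eqP: yx; apply: val_inj => /=.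
  by have := ltn_ord x; have := ltn_ord y; lia.
have : b *m last_block B rk rm = 0.
  apply/rowP => y; rewrite [RHS]mxE -(aB0 (last_ord rm y)); last by rewrite last_ordE leq_addr.
  rewrite aE -mulmxA mul_rowsub_mx mul1mx !mxE.
  by apply: eq_bigr => x _; rewrite !mxE.
by move=> /(congr1 (mulmx^~ (invmx (last_block B rk rm)))); rewrite mulmxK// mul0mx aE => ->; rewrite mul0mx.
Qed.

(** For [r = m - l], [last_block_row] gives a row [a l] such that [a l *m B] is 1 in column [l] and
    0 after it. Solving [a l *m B *m y = 0] for [y l] defines row [l] of [C]. Induction on the block
    size shows that these relations annihilate the last rows of [B *m y]. *)
Lemma feedback_matrix B :
  (forall i (ik : (i <= k)%N) (im : (i <= m)%N),
     (1 <= i <= minn k m.-1)%N -> last_block B ik im \in unitmx) ->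
  exists2 C : 'M[R]_m, forall l j : 'I_m, (l <= j)%N -> C l j = 0 &
    forall (l : 'I_m) (i : 'I_k) (y : 'cV[R]_m), (0 < l)%N -> (k + l = m + i)%N ->
      (forall l' : 'I_m, (l <= l')%N -> y l' 0 = \sum_j C l' j * y j 0) ->
      (B *m y) i 0 = 0.
Proof.
move=> blocks.
(* The corner block of size [m - l] is among those assumed invertible; for other [l] the row of [C]
   is zero, which prescribes [y l = 0]. *)
pose ok (l : 'I_m) := (1 <= m - l <= minn k m.-1)%N.
pose Q (l : 'I_m) (a : 'rV[R]_k) := ok l ->
  (forall i : 'I_k, (i < k - (m - l))%N -> a 0 i = 0) /\
  (forall j : 'I_m, (l <= j)%N -> (a *m B) 0 j = (j == l)%:R).
have /fin_all_exists[a aP] : forall l, exists a, Q l a.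
  move=> l; have [okl|nok] := boolP (ok l); last by exists 0 => okl; rewrite okl in nok.
  have [lk lm] : (m - l <= k)%N /\ (m - l <= m)%N by move: okl; rewrite /ok; lia.
  have l0 : (0 < m - l)%N by have := ltn_ord l; lia.
  have [a a0 aB] := last_block_row l0 (blocks _ lk lm okl).
  exists a => _; split=> // j lj; rewrite aB; last by lia.
  by congr (_%:R); congr nat_of_bool; apply/eqP/eqP => [?|->]; [apply: val_inj => /=; lia|have := ltn_ord l; lia].
pose C : 'M[R]_m := \matrix_(l, j) (if ok l then (j == l)%:R - (a l *m B) 0 j else 0).
exists C => [l j lj|].
  rewrite mxE; case: ifPn => // okl; have [_ aB] := aP l okl.
  by rewrite aB// subrr.
have main r : (r <= minn k m.-1)%N -> forall y : 'cV[R]_m,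
    (forall l' : 'I_m, (m - r <= l')%N -> y l' 0 = \sum_j C l' j * y j 0) ->
    forall i : 'I_k, (k - r <= i)%N -> (B *m y) i 0 = 0.
  elim: r => [_ y _ i|r IH rle y yr i]; first by have := ltn_ord i; lia.
  have IHy : forall i : 'I_k, (k - r <= i)%N -> (B *m y) i 0 = 0.
    by apply: IH; [lia|move=> l' rl'; apply: yr; lia].
  rewrite leq_eqVlt => /predU1P[ir|]; last by move=> ?; apply: IHy; lia.
  have lm : (m - r.+1 < m)%N by lia.
  pose l := Ordinal lm; have okl : ok l by rewrite /ok/=; lia.
  have [al0 alB] := aP l okl.
  have aBy : (a l *m (B *m y)) 0 0 = 0.
    rewrite mulmxA mxE.
    transitivity (y l 0 - \sum_j C l j * y j 0); last first.
      by rewrite -(yr l (leqnn _)) subrr.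
    rewrite [X in X - _](_ : _ = \sum_j (j == l)%:R * y j 0); last first.
      rewrite (bigD1 l)//= eqxx mul1r big1 ?addr0// => j /negbTE->.
      by rewrite mul0r.
    rewrite -sumrB; apply: eq_bigr => j _; rewrite [C l j]mxE okl -mulrBl.
    by congr (_ * _); ring.
  have : a l 0 i * (B *m y) i 0 = 0.
    rewrite -[RHS]aBy [RHS]mxE (bigD1 i)//= big1 ?addr0// => j ji.
    have [jr|jr] := leqP (k - r) j; first by rewrite IHy ?mulr0.
    rewrite al0 ?mul0r//=; have : (j != i :> nat) by []. lia.
  move=> /eqP; rewrite mulf_eq0 => /orP[/eqP ai0|/eqP//].
  (* If the coefficient at row [i] vanished, [a l] would be supported on the last [r] rows and
     annihilate the last [r] columns, against its entry 1 in column [l]. *)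
  have a0 : a l = 0.
    have a0 (i' : 'I_k) : (i' < k - r)%N -> a l 0 i' = 0.
      rewrite leq_eqVlt => /predU1P[i'r|i'r].
        by rewrite (_ : i' = i)//; apply: val_inj => /=; lia.
      by apply: al0 => /=; lia.
    have [r0|r0] := posnP r.
      by apply/rowP => i'; rewrite mxE a0// r0 subn0.
    have [rk rm] : (r <= k)%N /\ (r <= m)%N by lia.
    apply: (last_block_row_inj (blocks r rk rm _)) => //; first by lia.
    move=> j rj; rewrite alB/=; last by lia.
    by case: eqP => // /(congr1 val)/=; lia.
  have := alB l (leqnn _); rewrite a0 mul0mx mxE eqxx => /eqP.
  by rewrite eq_sym oner_eq0.
move=> l i y l0 kl yl; apply: (main (m - l)%N); have := ltn_ord l; have := ltn_ord i; try lia.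
by move=> ? ? l' ll'; apply: yl; lia.
Qed.
End LinearAlgebra.

(** * The optimal time *)

Section OptimalTime.
Context {R : realType}.
Local Notation mu := (@lebesgue_measure R).

(** The continuous function [1 / l1 - 1 / l2] has a positive minimum on [[0, 1]], which bounds the
    difference of the integrals from below. *)
Lemma Rintegral_inv_lt (l1 l2 : R -> R) :
  [lipschitz l1 x | x in `[0, 1]%classic] ->
  [lipschitz l2 x | x in `[0, 1]%classic] ->
  (forall x, 0 <= x <= 1 -> 0 < l1 x < l2 x) ->
  \int[mu]_(x in `[0, 1]) (l2 x)^-1 < \int[mu]_(x in `[0, 1]) (l1 x)^-1.
Proof.
move=> /lipschitz_clamp_continuous c1 /lipschitz_clamp_continuous c2 l12.
have cl l : \int[mu]_(x in `[0, 1]) (l x)^-1 =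
    \int[mu]_(x in `[0, 1]) ((l \o clamp) x)^-1.
  by apply: eq_Rintegral => x; rewrite inE/= in_itv/= => /clamp_id->.
have l12c x : 0 < (l1 \o clamp) x < (l2 \o clamp) x by exact: l12 (clamp_itv x).
rewrite (cl l1) (cl l2); move: (l1 \o clamp) (l2 \o clamp) c1 c2 l12c => {cl l12} {}l1 {}l2 c1 c2 l12.
have [l10 l20] : (forall x, 0 < l1 x) /\ (forall x, 0 < l2 x).
  by split => x; have /andP[h1 h2] := l12 x => //; exact: lt_trans h2.
have ic (f : R -> R) : continuous f -> mu.-integrable `[0, 1] (EFin \o f).
  move=> cf; apply: continuous_compact_integrable; first exact: segment_compact.
  exact: continuous_subspaceT.
have cV1 : continuous (fun x => (l1 x)^-1).
  by move=> x; apply: cvgV; [rewrite gt_eqF|exact: c1].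
have cV2 : continuous (fun x => (l2 x)^-1).
  by move=> x; apply: cvgV; [rewrite gt_eqF|exact: c2].
have cd : continuous (fun x => (l1 x)^-1 - (l2 x)^-1).
  by move=> x; apply: cvgB; [exact: cV1|exact: cV2].
have [c _ cP] := EVT_min ler01 (continuous_subspaceT cd).
rewrite -subr_gt0 -RintegralB//; [|exact: ic|exact: ic].
apply: (@lt_le_trans _ _ (\int[mu]_(x in `[0, 1]) ((l1 c)^-1 - (l2 c)^-1))).
  rewrite Rintegral_cst// [X in fine X](_ : _ = 1%:E)/=.
    rewrite mulr1 subr_gt0 ltf_pV2 ?posrE//; by case/andP: (l12 c).
  by rewrite [LHS]lebesgue_measure_itv/= lte_fin ltr01 -EFinB subr0.
apply: le_Rintegral => [||/=|]; [by []|by apply: ic => ?; exact: cvg_cst|exact: ic|].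
by move=> x x01; exact: cP.
Qed.

Context (k m : nat) (lambda : 'I_(k + m) -> R -> R).
Hypothesis k_gt0 : (0 < k)%N.
Hypothesis m_gt0 : (0 < m)%N.
Hypothesis lambda_lip : forall i, [lipschitz lambda i x | x in `[0, 1]%classic].
Hypothesis Sigma_increasing : forall x, x \in `[0, 1] ->
  forall i j : 'I_(k + m), (i < j)%N -> Sigma lambda x i i < Sigma lambda x j j.
Hypothesis Sigma_sign : forall x, x \in `[0, 1] -> forall i : 'I_(k + m),
  if (i < k)%N then Sigma lambda x i i < 0 else 0 < Sigma lambda x i i.

Definition crossing_time (i : 'I_(k + m)) : R :=
  \int[mu]_(x in `[0, 1]) (lambda i x)^-1.

Lemma speed_sign_lshift (i : 'I_k) : speed_sign (lshift m i) = -1 :> R.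
Proof. by rewrite /speed_sign /= ltn_ord. Qed.

Lemma speed_sign_rshift (j : 'I_m) : speed_sign (rshift k j) = 1 :> R.
Proof. by rewrite /speed_sign /= ltnNge leq_addr. Qed.

Lemma lambda_gt0 i x : 0 <= x <= 1 -> 0 < lambda i x.
Proof.
move=> x01; have xI : x \in `[0, 1] by rewrite in_itv.
have := Sigma_sign xI i; rewrite SigmaE /speed_sign.
by case: (i < k)%N; rewrite ?mulN1r ?mul1r ?oppr_lt0.
Qed.

Lemma crossing_time_lt_l (i j : 'I_k) : (i < j)%N ->
  crossing_time (lshift m i) < crossing_time (lshift m j).
Proof.
move=> ij; apply: Rintegral_inv_lt => // x x01; rewrite lambda_gt0//=.
have xI : x \in `[0, 1] by rewrite in_itv.
have := @Sigma_increasing _ xI (lshift m i) (lshift m j) ij.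
by rewrite !SigmaE !speed_sign_lshift !mulN1r ltrN2.
Qed.

Lemma crossing_time_lt_r (i j : 'I_m) : (i < j)%N ->
  crossing_time (rshift k j) < crossing_time (rshift k i).
Proof.
move=> ij; apply: Rintegral_inv_lt => // x x01; rewrite lambda_gt0//=.
have xI : x \in `[0, 1] by rewrite in_itv.
have := @Sigma_increasing _ xI (rshift k i) (rshift k j).
by rewrite /= ltn_add2l ij => /(_ isT); rewrite !SigmaE !speed_sign_rshift !mul1r.
Qed.

Lemma crossing_time_gt0 i : 0 < crossing_time i.
Proof.
have [phi [psi [K tt]]] := travel_time_exists (lambda_lip i) (fun x => @lambda_gt0 i x).
by rewrite /crossing_time -(tt_1 tt) -(tt_0 tt) (tt_mono tt) ltr01.
Qed.

Lemma tauE (i : 'I_(k + m)) (n : nat) : n = i.+1 -> tau lambda n = crossing_time i.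
Proof. by move=> ->; rewrite /tau /= valK. Qed.

(** With indices from 0, [k + j = m + i] describes the pairs summed in both cases of [Topt]; it
    gives [j = m + i - k] when [k <= m] and [i = k + j - m] otherwise. *)
Lemma Topt_ge_pair (i : 'I_k) (j : 'I_m) : (k + j = m + i)%N ->
  crossing_time (lshift m i) + crossing_time (rshift k j) <= Topt lambda.
Proof.
move=> kj; have jm := ltn_ord j; have ik := ltn_ord i.
rewrite /Topt; case: ifPn => km.
  rewrite le_max; apply/orP; left.
  rewrite -(@tauE (lshift m i) i.+1)// -(@tauE (rshift k j) (m + i.+1))/=; last by lia.
  apply: (@Order.TotalTheory.le_bigmax_seq _ _ _ _ _ i.+1 xpredT
    (fun i => tau lambda i + tau lambda (m + i))) => //.
  by rewrite mem_index_iota; lia.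
rewrite -(@tauE (lshift m i) (k + j.+1 - m))/=; last by lia.
rewrite -(@tauE (rshift k j) (k + j.+1))/=; last by lia.
apply: (@Order.TotalTheory.le_bigmax_seq _ _ _ _ _ j.+1 xpredT
  (fun l => tau lambda (k + l - m) + tau lambda (k + l))) => //.
by rewrite mem_index_iota; lia.
Qed.

(** It suffices to treat [j = 0], the slowest wave. If [m < k], its crossing time is only one
    summand in [Topt], in the term of the pair [(k - m, 0)]. *)
Lemma Topt_ge_first (j : 'I_m) : crossing_time (rshift k j) <= Topt lambda.
Proof.
pose o := Ordinal m_gt0.
apply: (@le_trans _ _ (crossing_time (rshift k o))).
  have [j0|j0] := posnP j; first by rewrite (_ : j = o)//; exact: val_inj.
  exact/ltW/crossing_time_lt_r.
have [km|km] := leqP k m.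
  by rewrite /Topt km le_max -(@tauE (rshift k o) k.+1) ?lexx ?orbT//= addn0.
have mk : (k - m < k)%N by lia.
apply: le_trans (@Topt_ge_pair (Ordinal mk) o _); last by rewrite /=; lia.
by rewrite lerDr ltW// crossing_time_gt0.
Qed.

Lemma Topt_gtP (T : R) : 0 < T -> T < Topt lambda ->
  (exists (i : 'I_k) (j : 'I_m), (k + j = m + i)%N /\
    T < crossing_time (lshift m i) + crossing_time (rshift k j)) \/
  T < crossing_time (rshift k (Ordinal m_gt0)).
Proof.
move=> T0 TT; have [|h2] := ltP T (crossing_time (rshift k (Ordinal m_gt0))); first by right.
left; apply: contrapT => h1.
have {}h1 (i : 'I_k) (j : 'I_m) : (k + j = m + i)%N ->
    crossing_time (lshift m i) + crossing_time (rshift k j) <= T.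
  by move=> kj; rewrite leNgt; apply/negP => ?; apply: h1; exists i, j.
move: TT; rewrite ltNge => /negP; apply; rewrite /Topt; case: ifPn => km.
  rewrite ge_max; apply/andP; split; last by rewrite (@tauE (rshift k (Ordinal m_gt0)))//= addn0.
  (* [0 < T] takes care of the initial value 0 of the maximum. *)
  rewrite big_nat_cond; apply: (big_ind (fun z => z <= T)) => [|x y xT yT|i]; first exact: ltW.
    by rewrite ge_max xT.
  rewrite andbT => /andP[i0 ik].
  have i'k : (i.-1 < k)%N by lia.
  have j'm : (m + i.-1 - k < m)%N by lia.
  have := h1 (Ordinal i'k) (Ordinal j'm); rewrite -(@tauE (lshift m (Ordinal i'k)) i)/=; last by lia.
  by rewrite -(@tauE (rshift k (Ordinal j'm)) (m + i))/=; [apply; lia|lia].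
rewrite big_nat_cond; apply: (big_ind (fun z => z <= T)) => [|x y xT yT|l]; first exact: ltW.
  by rewrite ge_max xT.
rewrite andbT => /andP[l0 lm].
have i'k : (k + l.-1 - m < k)%N by lia.
have j'm : (l.-1 < m)%N by lia.
have := h1 (Ordinal i'k) (Ordinal j'm); rewrite -(@tauE (lshift m (Ordinal i'k)) (k + l - m))/=; last by lia.
by rewrite -(@tauE (rshift k (Ordinal j'm)) (k + l))/=; [apply; lia|lia].
Qed.
End OptimalTime.

(** * Controllability *)

Section Controllability.
Context {R : realType} (k m : nat).
Local Notation mu := (@lebesgue_measure R).
Variables (lambda : 'I_(k + m) -> R -> R) (B : 'M[R]_(k, m)).
Hypothesis k_gt0 : (0 < k)%N.
Hypothesis m_gt0 : (0 < m)%N.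
Hypothesis lambda_lip : forall i, [lipschitz lambda i x | x in `[0, 1]%classic].
Hypothesis Sigma_increasing : forall x, x \in `[0, 1] ->
  forall i j : 'I_(k + m), (i < j)%N -> Sigma lambda x i i < Sigma lambda x j j.
Hypothesis Sigma_sign : forall x, x \in `[0, 1] -> forall i : 'I_(k + m),
  if (i < k)%N then Sigma lambda x i i < 0 else 0 < Sigma lambda x i i.
Variables (phi psi : 'I_(k + m) -> R -> R) (K : 'I_(k + m) -> R).
Hypothesis tt : forall i, travel_time (lambda i) (phi i) (psi i) (K i).

Let tau_l (i : 'I_k) : R := crossing_time lambda (lshift m i).
Let tau_r (j : 'I_m) : R := crossing_time lambda (rshift k j).

Let phi1 i : phi i 1 = crossing_time lambda i.
Proof. exact: tt_1 (tt i). Qed.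

Let tau_r_le (i j : 'I_m) : (i <= j)%N -> tau_r j <= tau_r i.
Proof.
rewrite leq_eqVlt => /predU1P[ij|]; first by rewrite (_ : i = j)//; exact: val_inj.
by move=> ij; exact/ltW/crossing_time_lt_r.
Qed.

Let tau_l_le (i j : 'I_k) : (i <= j)%N -> tau_l i <= tau_l j.
Proof.
rewrite leq_eqVlt => /predU1P[ij|]; first by rewrite (_ : i = j)//; exact: val_inj.
by move=> ij; exact/ltW/crossing_time_lt_l.
Qed.

Let tau_gt0 i : 0 < crossing_time lambda i.
Proof. exact: crossing_time_gt0. Qed.

Lemma ae_add_shift (P : R -> Prop) (s : R) : {ae mu, forall t, P t} ->
  {ae mu, forall t, P (t + s)}.
Proof.
move=> /(@ae_comp R (fun t => t + s) 1) H; apply: H => // x y.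
by rewrite opprD addrACA subrr addr0 mul1r.
Qed.

Lemma ae_opp (P : R -> Prop) : {ae mu, forall t, P t} ->
  {ae mu, forall t, P (- t)}.
Proof.
move=> /(@ae_comp R (fun t => - t) 1) H; apply: H => // x y.
by rewrite -opprD normrN mul1r.
Qed.

Lemma ae_phi (P : R -> Prop) i (s : R) : {ae mu, forall t, P t} ->
  {ae mu, forall x, P (s + phi i x)}.
Proof.
move=> /(ae_comp (tt_gt0 (tt i))) H.
apply: H => x y; rewrite opprD addrACA subrr add0r.
by rewrite -{1}(tt_K (tt i) x) -{1}(tt_K (tt i) y) (tt_lip_inv (tt i)).
Qed.

Lemma ae_psi (P : R -> Prop) i : {ae mu, forall x, P x} ->
  {ae mu, forall c, P (psi i c)}.
Proof.
move=> /(ae_comp (tt_gt0 (tt i))) H.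
apply: H => x y; rewrite -{1}(tt_Kinv (tt i) x) -{1}(tt_Kinv (tt i) y).
exact: tt_lip (tt i) _ _.
Qed.

Lemma traces (T : R) u0 W (u : R -> R -> 'cV[R]_(k + m)) : 0 < T ->
  broad_solution lambda B T u0 W u ->
  exists f : 'I_(k + m) -> R -> R, forall i,
    (forall x, x \in `[0, 1] ->
      {ae mu, forall t, 0 < t < T -> u t x i 0 = f i (speed_sign i * t + phi i x)}) /\
    (forall t, t \in `[0, T] ->
      {ae mu, forall x, 0 < x < 1 -> u t x i 0 = f i (speed_sign i * t + phi i x)}).
Proof.
move=> T0 sol.
have /fin_all_exists[f fP] : forall i, exists g : R -> R,
    (forall x, x \in `[0, 1] ->
      {ae mu, forall t, 0 < t < T -> u t x i 0 = g (speed_sign i * t + phi i x)}) /\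
    (forall t, t \in `[0, T] ->
      {ae mu, forall x, 0 < x < 1 -> u t x i 0 = g (speed_sign i * t + phi i x)}).
  by move=> i; have [g g1 g2] := transport T0 (tt i) sol; exists g.
by exists f.
Qed.

Lemma left_trace (T : R) u0 W (u : R -> R -> 'cV[R]_(k + m))
    (f : 'I_(k + m) -> R -> R) (i : 'I_k) :
  broad_solution lambda B T u0 W u ->
  (forall i x, x \in `[0, 1] ->
      {ae mu, forall t, 0 < t < T -> u t x i 0 = f i (speed_sign i * t + phi i x)}) ->
  {ae mu, forall t, 0 < t < T ->
    f (lshift m i) (- t) = (B *m \col_j f (rshift k j) t) i 0}.
Proof.
move=> sol fx; have I0 : (0 : R) \in `[0, 1] by rewrite in_itv/= lexx ler01.
have /ae_forall fr : forall j : 'I_m, {ae mu, forall t, 0 < t < T ->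
    u t 0 (rshift k j) 0 = f (rshift k j) t}.
  move=> j; apply: aeS (fx (rshift k j) 0 I0) => t H t01.
  by rewrite H// speed_sign_rshift mul1r (tt_0 (tt _)) addr0.
have lft : {ae mu, forall t, 0 < t < T ->
    u t 0 (lshift m i) 0 = (B *m \col_j f (rshift k j) t) i 0}.
  apply: aeS2 (sol_left sol) fr => t /= H1 H2 tT.
  have := H1; rewrite in_itv/= => /(_ tT)/matrixP/(_ i 0).
  rewrite !mxE => ->; apply: eq_bigr => j _; rewrite !mxE.
  by rewrite H2.
apply: aeS2 lft (fx (lshift m i) 0 I0) => t H1.
by rewrite speed_sign_lshift mulN1r (tt_0 (tt _)) addr0 => H2 tT; rewrite -H2// H1.
Qed.

(** Each pair [(l, j)] contributes one point value, through a matrix whose only possibly nonzero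
    entry [C l j] is in row [l] and column [k + j]; [enum_val] lists the pairs. *)
Lemma feedback_lawE (C : 'M[R]_m) (xs : 'I_m -> 'I_m -> R)
    (u : R -> R -> 'cV[R]_(k + m)) t (l : 'I_m) :
  feedback_law
    (fun r : 'I_#|{: 'I_m * 'I_m}| => let p := enum_val r in
       C p.1 p.2 *: delta_mx p.1 (rshift k p.2))
    (fun r => let p := enum_val r in xs p.1 p.2)
    (fun=> 0) u t l 0 = \sum_j C l j * u t (xs l j) (rshift k j) 0.
Proof.
rewrite /feedback_law !mxE [X in _ + X](_ : _ = 0) ?addr0; last first.
  rewrite -[RHS](Rintegral_set0 mu (fun=> 0)) /Rintegral integral_set0.
  by congr fine; apply: integral0_eq => y _; rewrite mul0mx mxE.
rewrite summxE.
rewrite -(big_enum_val (A := {: 'I_m * 'I_m}) (fun p : 'I_m * 'I_m =>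
  ((C p.1 p.2 *: delta_mx p.1 (rshift k p.2)) *m u t (xs p.1 p.2)) l 0)).
rewrite -(pair_big xpredT xpredT (fun l' j =>
  ((C l' j *: delta_mx l' (rshift k j)) *m u t (xs l' j)) l 0))/=.
rewrite (bigD1 l)//= [X in _ + X]big1 ?addr0; last first.
  move=> l' l'l; apply: big1 => j _; rewrite -scalemxAl !mxE big1 ?mulr0// => s _.
  by rewrite !mxE eq_sym (negbTE l'l) mul0r.
apply: eq_bigr => j _; rewrite -scalemxAl !mxE; congr (_ * _).
rewrite (bigD1 (rshift k j))//= !mxE !eqxx mul1r big1 ?addr0// => s sj.
by rewrite !mxE (negbTE sj) andbF mul0r.
Qed.

(** From this point, wave [j] reaches [x = 0] at the same moment as wave [l] started at [x = 1]. The
    default 0 is an admissible point, used where [C l j = 0]. *)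
Let point (l j : 'I_m) : R := if (j < l)%N then psi (rshift k j) (tau_r l) else 0.

Lemma point_admissible :
  admissible_feedback
    (fun r : 'I_#|{: 'I_m * 'I_m}| => let p := enum_val r in point p.1 p.2)
    (fun=> (0 : 'M[R]_(m, k + m))).
Proof.
split=> [r|j l]; last first.
  split; first exact: measurable_cst.
  by exists 0; apply: aeW => y _; rewrite mxE normr0.
rewrite /point in_itv/=; case: ifPn => [lt|_]; last by rewrite lexx ltr01.
have : 0 < psi (rshift k (enum_val r).2) (tau_r (enum_val r).1) < 1.
  by apply: (psi_itvoo (tt _)); rewrite phi1 tau_gt0/=; exact: crossing_time_lt_r.
by move=> /andP[/ltW-> ->].
Qed.

Lemma feedback_null_control (C : 'M[R]_m) :
  (forall l j : 'I_m, (l <= j)%N -> C l j = 0) ->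
  (forall (l : 'I_m) (i : 'I_k) (y : 'cV[R]_m), (0 < l)%N -> (k + l = m + i)%N ->
      (forall l' : 'I_m, (l <= l')%N -> y l' 0 = \sum_j C l' j * y j 0) ->
      (B *m y) i 0 = 0) ->
  feedback_null_controls lambda B
    (fun r : 'I_#|{: 'I_m * 'I_m}| => let p := enum_val r in
       C p.1 p.2 *: delta_mx p.1 (rshift k p.2))
    (fun r => let p := enum_val r in point p.1 p.2)
    (fun=> 0) (Topt lambda).
Proof.
move=> C0 CB u0 u _ sol; set T := Topt lambda in sol *.
have T_r j : tau_r j <= T by exact: Topt_ge_first.
have T_pair (i : 'I_k) (j : 'I_m) : (k + j = m + i)%N -> tau_l i + tau_r j <= T.
  exact: Topt_ge_pair.
have tr0 j : 0 < tau_r j by exact: tau_gt0.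
have tl0 i : 0 < tau_l i by exact: tau_gt0.
have T0 : 0 < T by exact: lt_le_trans (tr0 (Ordinal m_gt0)) (T_r _).
have I0 : (0 : R) \in `[0, 1] by rewrite in_itv/= lexx ler01.
have I1 : (1 : R) \in `[0, 1] by rewrite in_itv/= lexx ler01.
have IT : T \in `[0, T] by rewrite in_itv/= lexx ltW.
have [f fP] := traces T0 sol.
(* Both [u t 1] in component [l] and [u t (point l j)] in component [j] are traces at [x = 0] at
   time [t + tau_r l], so the feedback prescribes the relation there. *)
have rel l : {ae mu, forall c, tau_r l < c < T + tau_r l ->
    f (rshift k l) c = \sum_j C l j * f (rshift k j) c}.
  have /ae_forall Hj : forall j, {ae mu, forall t, 0 < t < T ->
      C l j * u t (point l j) (rshift k j) 0 = C l j * f (rshift k j) (t + tau_r l)}.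
    move=> j; have [lj|jl] := leqP l j.
      by apply: aeW => t _; rewrite C0// !mul0r.
    rewrite /point jl; have tlj : 0 <= tau_r l <= phi (rshift k j) 1.
      by rewrite phi1 ltW//= ltW// crossing_time_lt_r.
    have H0 := (fP (rshift k j)).1 _ _; have := H0 (psi (rshift k j) (tau_r l)).
    rewrite in_itv/= (psi_itvcc (tt _) tlj) => /(_ isT); apply: aeS => t H tT.
    by rewrite H// speed_sign_rshift mul1r (tt_Kinv (tt _)).
  have Hl := (fP (rshift k l)).1 1 I1.
  have Hs : {ae mu, forall t, 0 < t < T ->
      u t 1 (rshift k l) 0 = \sum_j C l j * u t (point l j) (rshift k j) 0}.
    apply: aeS (sol_right sol) => t; rewrite in_itv/= => /[apply] /matrixP/(_ l 0).
    by rewrite mxE (feedback_lawE _ point).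
  have : {ae mu, forall t, 0 < t < T ->
      f (rshift k l) (t + tau_r l) = \sum_j C l j * f (rshift k j) (t + tau_r l)}.
    have Hsj : {ae mu, forall t, 0 < t < T ->
        u t 1 (rshift k l) 0 = \sum_j C l j * f (rshift k j) (t + tau_r l)}.
      apply: aeS2 Hs Hj => t H1 H2 tT; rewrite (H1 tT).
      by apply: eq_bigr => j _; exact: H2.
    apply: aeS2 Hsj Hl => t H1 H2 tT; rewrite -H1// H2//.
    by rewrite speed_sign_rshift mul1r phi1.
  move=> /(@ae_add_shift _ (- tau_r l)); apply: aeS => c + /andP[c1 c2].
  by rewrite subrK; apply; rewrite subr_gt0 c1 ltrBlDr.
(* Induction on [l], as [C] is strictly lower triangular: for [j < l] the window [T + tau_r j] is at
   least as long, and [tau_r l <= T] makes [rel] available. *)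
have zero n (l : 'I_m) : (l < n)%N -> {ae mu, forall c, T < c < T + tau_r l ->
    f (rshift k l) c = 0}.
  elim: n l => // n IH l; rewrite ltnS => ln.
  have /ae_forall Hj : forall j : 'I_m, {ae mu, forall c, (j < l)%N ->
      T < c < T + tau_r j -> f (rshift k j) c = 0}.
    move=> j; have [lj|jl] := leqP l j; first by apply: aeW => t.
    by apply: aeS (IH j _) => [c H _|]; [exact: H|exact: leq_trans jl ln].
  apply: aeS2 (rel l) Hj => c Hr Hz /andP[c1 c2].
  rewrite Hr ?c2 ?andbT; last exact: le_lt_trans (T_r l) c1.
  apply: big1 => j _; have [lj|jl] := leqP l j; first by rewrite C0// mul0r.
  rewrite Hz ?mulr0// c1 (lt_le_trans c2)// lerD2l.
  exact/tau_r_le/ltnW.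
(* Ensures that the times [T - phi x] at which component [i] left [x = 0] are positive. *)
have T_l i : tau_l i <= T.
  have [kmi|mik] := ltnP k (m + i).
    have jm : (m + i - k < m)%N by have := ltn_ord i; lia.
    apply: le_trans (T_pair i (Ordinal jm) _); last by rewrite /=; lia.
    by rewrite lerDl ltW.
  have i'k : (k - m < k)%N by lia.
  apply: (@le_trans _ _ (tau_l (Ordinal i'k))); first by apply: tau_l_le => /=; lia.
  apply: le_trans (T_pair (Ordinal i'k) (Ordinal m_gt0) _); last by rewrite /=; lia.
  by rewrite lerDl ltW.
have zero_l i : {ae mu, forall t, 0 < t < T -> T - tau_l i < t ->
    f (lshift m i) (- t) = 0}.
  have fx j x := (fP j).1 x.
  have H := left_trace i sol fx; have Hr := ae_forall rel.
  apply: aeS2 H Hr => t H1 H2 tT it.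
  rewrite H1//; set y := \col_j _; have /andP[t0 tT'] := tT.
  have relt l : tau_r l < t -> y l 0 = \sum_j C l j * y j 0.
    move=> lt; rewrite mxE H2.
      by apply: eq_bigr => j _; rewrite mxE.
    by rewrite lt (lt_le_trans tT')// lerDl ltW.
  (* Row [i] is paired with [l = m + i - k], which is positive in the first case. As
     [T - tau_l i >= tau_r l], all relations from [l] on hold at time [t]. *)
  have [kmi|mik] := ltnP k (m + i).
    have jm : (m + i - k < m)%N by have := ltn_ord i; lia.
    apply: (CB (Ordinal jm)) => [/=|/=|l' l'l]; [lia|lia|].
    apply: relt; apply: le_lt_trans (tau_r_le l'l) _.
    apply: le_lt_trans it; rewrite lerBrDl; apply: T_pair => /=; lia.
  (* Now [i <= k - m], so [t] exceeds the largest of the [tau_r]: all relations hold, and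
     triangularity forces [y = 0]. *)
  have i'k : (k - m < k)%N by lia.
  have y0 n (j : 'I_m) : (j < n)%N -> y j 0 = 0.
    elim: n j => // n IH j; rewrite ltnS => jn; rewrite relt.
      apply: big1 => j' _; have [jj'|j'j] := leqP j j'; first by rewrite C0// mul0r.
      by rewrite IH ?mulr0//; exact: leq_trans j'j jn.
    apply: (@le_lt_trans _ _ (tau_r (Ordinal m_gt0))); first exact: tau_r_le.
    apply: le_lt_trans it; rewrite lerBrDl.
    apply: le_trans (T_pair (Ordinal i'k) (Ordinal m_gt0) _); last by rewrite /=; lia.
    by rewrite lerD2r; apply: tau_l_le => /=; lia.
  by rewrite mxE big1// => j _; rewrite (y0 m)// mulr0.
have /ae_forall : forall i, {ae mu, forall x, 0 < x < 1 -> u T x i 0 = 0}.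
  move=> i; have Hi := (fP i).2 T IT; case: (split_ordP i) Hi => [i' ->|j ->] Hi.
    have := ae_phi (lshift m i') (- T) (ae_opp (zero_l i')).
    apply: aeS2 Hi => x H1 H2 x01; rewrite H1// speed_sign_lshift mulN1r.
    have /andP[p0 p1] := phi_itvoo (tt (lshift m i')) x01.
    rewrite phi1 -/(tau_l i') in p1; have Ti := T_l i'.
    move: H2; rewrite !opprD !opprK; apply; last by lra.
    by apply/andP; split; lra.
  have := ae_phi (rshift k j) T (zero m j (ltn_ord j)).
  apply: aeS2 Hi => x H1 H2 x01; rewrite H1// speed_sign_rshift mul1r H2//.
  have /andP[p0 p1] := phi_itvoo (tt (rshift k j)) x01.
  by rewrite ltrDl p0 ltrD2l /tau_r -phi1.
apply: aeS => x H; rewrite in_itv/= => x01; apply/colP => i.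
by rewrite H// mxE.
Qed.

(** A row vector [a] supported on rows from [i0] on, with [a *m B] equal to 1 in column [j0] and 0
    after it, evaluates [a *m B *m y] to 0 through the final condition and to 1 through the initial
    datum. *)
Lemma not_null_controllable (T : R) :
  (forall r (rk : (r <= k)%N) (rm : (r <= m)%N), (0 < r)%N ->
     last_block B rk rm \in unitmx) ->
  0 < T < Topt lambda ->
  exists2 u0 : R -> 'cV[R]_(k + m), L2col 0 1 u0 &
    forall (W : R -> 'cV[R]_m) (u : R -> R -> 'cV[R]_(k + m)),
      broad_solution lambda B T u0 W u -> ~ vanishes (u T).
Proof.
move=> blocks /andP[T0 TT].
have I0 : (0 : R) \in `[0, T] by rewrite in_itv/= lexx ltW.
have IT : T \in `[0, T] by rewrite in_itv/= lexx ltW.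
have L2c (c : 'cV[R]_(k + m)) : L2col 0 1 (fun=> c).
  move=> i; split; first exact: measurable_cst.
  have ic : mu.-integrable `[0, 1] (EFin \o (fun _ : R => c i 0 ^+ 2)).
    apply: continuous_compact_integrable; first exact: segment_compact.
    by apply: continuous_subspaceT => ?; exact: cvg_cst.
  by apply: integrableS ic => //; apply: subset_itv; rewrite bnd_simp.
(* For arguments below [tau_r j] the backward characteristic meets [t = 0] before [x = 1], so the
   values are independent of the control. *)
have initial (j0 j : 'I_m) W u f : broad_solution lambda B T (fun=> delta_mx (rshift k j0) 0) W u ->
    (forall t, t \in `[0, T] -> {ae mu, forall x, 0 < x < 1 ->
       u t x (rshift k j) 0 = f (speed_sign (rshift k j) * t + phi (rshift k j) x)}) ->
    {ae mu, forall c, 0 < c < tau_r j -> f c = (j == j0)%:R}.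
  move=> sol /(_ 0 I0) Hf.
  have : {ae mu, forall x, 0 < x < 1 -> f (phi (rshift k j) x) = (j == j0)%:R}.
    apply: aeS2 Hf (sol_initial sol) => x + + x01.
    rewrite in_itv/= => /(_ x01); rewrite mulr0 add0r => <- /(_ x01) ->.
    by rewrite mxE eqxx andbT eq_rshift.
  move=> /(@ae_psi _ (rshift k j)); apply: aeS => c; rewrite (tt_Kinv (tt _)) => H c01.
  by apply: H; apply: (psi_itvoo (tt _)); rewrite phi1.
have final i u f : vanishes (u T) ->
    (forall t, t \in `[0, T] -> {ae mu, forall x, 0 < x < 1 ->
       u t x i 0 = f (speed_sign i * t + phi i x)}) ->
    {ae mu, forall c, 0 < c < crossing_time lambda i -> f (speed_sign i * T + c) = 0}.
  move=> van /(_ T IT) Hf.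
  have : {ae mu, forall x, 0 < x < 1 -> f (speed_sign i * T + phi i x) = 0}.
    apply: aeS2 Hf van => x + + x01.
    by rewrite in_itv/= => /(_ x01) <- /(_ x01) ->; rewrite mxE.
  move=> /(@ae_psi _ i); apply: aeS => c; rewrite (tt_Kinv (tt _)) => H c01.
  by apply: H; apply: (psi_itvoo (tt _)); rewrite phi1.
have finr j0 u f : vanishes (u T) -> (forall t, t \in `[0, T] -> {ae mu, forall x, 0 < x < 1 ->
       u t x (rshift k j0) 0 = f (speed_sign (rshift k j0) * t + phi (rshift k j0) x)}) ->
    {ae mu, forall c, T < c < T + tau_r j0 -> f c = 0}.
  move=> van Hf; have := ae_add_shift (- T) (final _ _ _ van Hf).
  apply: aeS => c; rewrite speed_sign_rshift mul1r subrKC => H /andP[c1 c2].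
  by apply: H; rewrite subr_gt0 c1 ltrBlDl.
have finl i u f : vanishes (u T) -> (forall t, t \in `[0, T] -> {ae mu, forall x, 0 < x < 1 ->
       u t x (lshift m i) 0 = f (speed_sign (lshift m i) * t + phi (lshift m i) x)}) ->
    {ae mu, forall t, T - tau_l i < t < T -> f (- t) = 0}.
  move=> van Hf; have := ae_opp (ae_add_shift T (final _ _ _ van Hf)).
  apply: aeS => t; rewrite speed_sign_lshift mulN1r => H /andP[t1 t2].
  rewrite -H; first by congr f; ring.
  by rewrite -/(tau_l i); apply/andP; split; lra.
(* If [T] is less than the crossing time of the slowest controlled wave, part of its initial datum
   is still inside at time [T]. *)
have [[i0 [j0 [kj Tij]]]|Tfirst] := Topt_gtP k_gt0 m_gt0 T0 TT; last first.
  pose o := Ordinal m_gt0; exists (fun=> delta_mx (rshift k o) 0); first exact: L2c.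
  move=> W u sol van; have [f fP] := traces T0 sol.
  have H1 := initial o o W u _ sol (fP (rshift k o)).2.
  have H2 := finr o u _ van (fP (rshift k o)).2.
  have [|x _] := @ae_itv_ex R T (tau_r o) (fun=> (1 : R) = 0) Tfirst.
    apply: aeS2 H1 H2 => c H1 H2 /andP[c1 c2].
    rewrite -H2; first by rewrite H1 ?eqxx// c2 (lt_trans T0).
    by rewrite c1 (lt_trans c2)// ltrDr.
  by move/eqP; rewrite oner_eq0.
exists (fun=> delta_mx (rshift k j0) 0); first exact: L2c.
move=> W u sol van; have [f fP] := traces T0 sol.
have [jm ik] : (j0 < m)%N /\ (i0 < k)%N by split.
have [rk rm] : (m - j0 <= k)%N /\ (m - j0 <= m)%N by lia.
have r0 : (0 < m - j0)%N by lia.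
have [kE mE] : (k - (m - j0))%N = i0 /\ (m - (m - j0))%N = j0 by lia.
have [a] := last_block_row r0 (blocks _ rk rm r0); rewrite kE mE => a0 aB.
have H1 : {ae mu, forall c, forall j : 'I_m, 0 < c < tau_r j -> f (rshift k j) c = (j == j0)%:R}.
  by apply: ae_forall => j; exact: initial sol (fP (rshift k j)).2.
have H2 : {ae mu, forall t, forall i : 'I_k, T - tau_l i < t < T -> f (lshift m i) (- t) = 0}.
  by apply: ae_forall => i; exact: finl van (fP (lshift m i)).2.
have H3 : {ae mu, forall t, forall i : 'I_k, 0 < t < T ->
    f (lshift m i) (- t) = (B *m \col_j f (rshift k j) t) i 0}.
  by apply: ae_forall => i; apply: (left_trace i sol) => i' x; exact: (fP i').1.
have tr0 j : 0 < tau_r j by exact: tau_gt0.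
have tl0 i : 0 < tau_l i by exact: tau_gt0.
(* This interval of times is nonempty precisely because [T < tau_l i0 + tau_r j0]. *)
have pq : Num.max 0 (T - tau_l i0) < Num.min T (tau_r j0).
  rewrite gt_max !lt_min T0 tr0/= gtrBl tl0/= ltrBlDl; exact: Tij.
have [|x _] := @ae_itv_ex R _ _ (fun=> (1 : R) = 0) pq; last by move=> /eqP; rewrite oner_eq0.
have H23 : {ae mu, forall t, forall i : 'I_k, 0 < t -> T - tau_l i < t < T ->
    (B *m \col_j f (rshift k j) t) i 0 = 0}.
  apply: aeS2 H2 H3 => t h2 h3 i t0 tT; rewrite -h3 ?h2//.
  by case/andP: tT => _ ->; rewrite t0.
apply: aeS2 H1 H23 => t h1 h2; rewrite gt_max lt_min => /andP[/andP[t0 t1] /andP[t2 t3]].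
set y := \col_j _ in h2.
(* For [j <= j0] the wave is at least as slow, so the trace at time [t] still comes from the initial
   datum; for [j > j0] it may depend on the control, but [a *m B] vanishes there. *)
have yE (j : 'I_m) : (j <= j0)%N -> y j 0 = (j == j0)%:R.
  by move=> jj0; rewrite mxE h1// t0 (lt_le_trans t3)// tau_r_le.
have <- : (a *m (B *m y)) 0 0 = 0.
  rewrite mxE big1// => i _; have [ii0|i0i] := ltnP i i0.
    by rewrite a0 ?mul0r.
  (* For [i >= i0] the crossing time is at least [tau_l i0], so [t] lies in the window where the
     final condition annihilates row [i]. *)
  rewrite h2 ?mulr0// t2 andbT; apply: le_lt_trans t1.
  by rewrite lerD2l lerN2 tau_l_le.
rewrite mulmxA mxE (bigD1 j0)//= big1 ?addr0 => [|j jj0].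
  by rewrite aB// yE// !eqxx mulr1.
have [j0j|jj0'] := leqP j0 j; last by rewrite yE ?(negbTE jj0) ?mulr0// ltnW.
by rewrite aB// (_ : (j == j0 :> nat) = false) ?mul0r//; apply/negbTE.
Qed.
End Controllability.

(** * Null controllability at [Topt] and its optimality *)

Theorem proposition1 (R : realType) (k m : nat)
    (lambda : 'I_(k + m) -> R -> R) (B : 'M[R]_(k, m))
    (k_gt0 : (0 < k)%N) (m_gt0 : (0 < m)%N)
    (lambda_lip : forall i, [lipschitz lambda i x | x in `[0, 1]%classic])
    (Sigma_increasing : forall x, x \in `[0, 1] ->
       forall i j : 'I_(k + m), (i < j)%N ->
         Sigma lambda x i i < Sigma lambda x j j)
    (Sigma_sign : forall x, x \in `[0, 1] -> forall i : 'I_(k + m),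
       if (i < k)%N then Sigma lambda x i i < 0 else 0 < Sigma lambda x i i)
    (B_blocks : forall i (ik : (i <= k)%N) (im : (i <= m)%N),
       (1 <= i <= minn k m.-1)%N -> last_block B ik im \in unitmx) :
  (exists (N : nat) (A : 'I_N -> 'M[R]_(m, k + m)) (xs : 'I_N -> R)
          (M : R -> 'M[R]_(m, k + m)),
     admissible_feedback xs M /\
     feedback_null_controls lambda B A xs M (Topt lambda)) /\
  (last_block B (geq_minl k m) (geq_minr k m) \in unitmx ->
   forall T : R, 0 < T < Topt lambda ->
     exists2 u0 : R -> 'cV[R]_(k + m), L2col 0 1 u0 &
       forall (W : R -> 'cV[R]_m) (u : R -> R -> 'cV[R]_(k + m)),
         L2col 0 T W -> broad_solution lambda B T u0 W u -> ~ vanishes (u T)).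
Proof.
have /fin_all_exists[phi /fin_all_exists[psi /fin_all_exists[K tt]]] :
    forall i, exists phi psi K, travel_time (lambda i) phi psi K.
  by move=> i; apply: travel_time_exists => // x; exact: lambda_gt0.
split.
  have [C C0 CB] := feedback_matrix B_blocks.
  (* Proving the second conjunct first fixes the four witnesses. *)
  do 4 eexists; split; last first.
    exact: (feedback_null_control k_gt0 m_gt0 lambda_lip Sigma_increasing Sigma_sign tt C0 CB).
  exact: (point_admissible lambda_lip Sigma_increasing Sigma_sign tt).
move=> minB T TT.
(* A size [r] is at most [minn k m.-1], or equals [minn k m], the size covered by the additional
   assumption. *)
have blocks r (rk : (r <= k)%N) (rm : (r <= m)%N) : (0 < r)%N ->
    last_block B rk rm \in unitmx.
  move=> r0; have [rs|rs] := leqP r (minn k m.-1).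
    by apply: B_blocks; rewrite r0.
  have rE : r = minn k m by lia.
  move: rk rm; rewrite rE => rk rm.
  by rewrite (bool_irrelevance rk (geq_minl k m)) (bool_irrelevance rm (geq_minr k m)).
have [u0 L2u0 H] := not_null_controllable k_gt0 m_gt0 lambda_lip
  Sigma_increasing Sigma_sign tt blocks TT.
by exists u0 => // W u _; exact: H.
Qed.
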